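(* There is a distributed algorithm in the LOCAL model for the client-server 2-spanner problem that always outputs a solution of size at most $O\!\left(\min\left\{\log\frac{|C|}{|V(C)|},\ \log\Delta_S\right\}\right)$ times the minimum, and terminates within $O(\log n\log\Delta_S)$ rounds with high probability.
   Context: Client-server 2-spanner problem: the input is a connected undirected graph $G=(V,E)$ whose edges are labeled as client edges $C\subseteq E$ and server edges $S\subseteq E$ (an edge may be both). The goal is a minimum-size set $H\subseteq S$ such that for every client edge $\{u,v\}\in C$ there is a path with at most 2 edges between $u$ and $v$ in $H$; the instance is assumed to admit such an $H$ (the optimum is taken over such $H$). $V(C)$ is the set of vertices incident to client edges, $n=|V|$, and $\Delta_S$ is the maximum degree of the subgraph consisting of the server edges. Distributed setting: the input graph is the communication network; vertices have unique IDs and initially know their incident edges and their types; synchronous rounds; each vertex outputs a subset of its incident edges. LOCAL model: messages of unbounded size. ''With high probability'' means with probability at least $1-1/n^c$ for a constant $c\geq1$. *)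

(* Defs.v *)
From mathcomp Require Import all_boot all_order all_algebra.
From mathcomp Require Import reals exp.

Set Implicit Arguments.
Unset Strict Implicit.
Unset Printing Implicit Defensive.

Import Order.TTheory GRing.Theory Num.Theory.

Section ClientServer2Spanner.
Variable V : finType.
Implicit Types (E C S F H : {set {set V}}) (u v : V).

(* Undirected edges are two-element sets of vertices. *)
Definition adj F : rel V := fun u v => [set u; v] \in F.

Definition simple_graph E : Prop := forall e, e \in E -> #|e| = 2.

Definition connected_graph E : Prop :=
  0 < #|V| /\ forall u v, connect (adj E) u v.

Definition two_spans H u v : Prop :=
  exists p : seq V, [/\ path (adj H) u p, last u p = v & size p <= 2].

Definition is_solution C S H : Prop :=
  H \subset S /\ forall u v, [set u; v] \in C -> two_spans H u v.

Definition is_minimum_solution C S H : Prop :=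
  is_solution C S H /\ forall H', is_solution C S H' -> #|H| <= #|H'|.

Definition max_degree F : nat := \max_(v : V) #|[set e in F | v \in e]|.

End ClientServer2Spanner.

Record cs_instance (V : finType) := CSInstance {
  edges : {set {set V}};
  clients : {set {set V}};
  servers : {set {set V}};
  edges_simple : simple_graph edges;
  edges_connected : connected_graph edges;
  clients_sub : clients \subset edges;
  servers_sub : servers \subset edges;
  instance_feasible : exists H, is_solution clients servers H
}.

(* A randomized algorithm in the LOCAL model. It is one object, run at every
   vertex of every network; a vertex gets no global information, not even the
   number of vertices.
   - The initial state depends on the vertex's own ID and on the list of its
     incident edges. The edge to the neighbour with ID [i] is listed as
     [(i, (b, b'))], where [b] says whether it is a client edge and [b']
     whether it is a server edge.
   - In a round, a vertex in state [s] draws a private uniform number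
     [r] in [{0, ..., draw_bound s}], sends [send s r i] to its neighbour with
     ID [i], and moves to [receive s r inbox], where [inbox] lists the messages
     received, each with the ID of its sender.
   - A vertex halts when it reaches a state [s] with [output s = Some ids]; it
     then outputs its incident edges to the neighbours with IDs in [ids].
   There is no bound on local computation or on message size. As initial
   knowledge and draws are finite objects, arbitrary types of states and
   messages convey no more than finite ones would. *)
Record local_algorithm := LocalAlgorithm {
  state : Type;
  message : Type;
  init : nat -> seq (nat * (bool * bool)) -> state;
  draw_bound : state -> nat;
  send : state -> nat -> nat -> message;
  receive : state -> nat -> seq (nat * message) -> state;
  output : state -> option (seq nat)
}.

Section Execution.
Variables (A : local_algorithm) (V : finType) (G : cs_instance V).
Variable id : V -> nat.

(* Listed by increasing ID, so that the order reveals nothing else. *)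
Definition neighbours (v : V) : seq V :=
  sort (fun u w => id u <= id w) (enum [set u | adj (edges G) v u]).

Definition configuration := {ffun V -> state A}.

Definition init_configuration : configuration :=
  [ffun v => init A (id v)
     [seq (id u, (adj (clients G) v u, adj (servers G) v u)) | u <- neighbours v]].

Definition halted (x : configuration) (v : V) : bool := output (x v).

Definition all_halted (x : configuration) : bool := [forall v, halted x v].

Definition draws (x : configuration) :=
  {dffun forall v : V, 'I_(draw_bound (x v)).+1}.

(* A halted vertex keeps its state and sends nothing. *)
Definition round (x : configuration) (r : draws x) : configuration :=
  [ffun v => if halted x v then x v else
     receive (x v) (r v)
       [seq (id u, send (x u) (r u) (id v)) | u <- neighbours v & ~~ halted x u]].

(* Not restricted to the edges of the graph: if some [ids] designates a
   non-neighbour, the resulting set is not a set of server edges. *)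
Definition output_edges (x : configuration) : {set {set V}} :=
  \bigcup_(v : V) [set [set v; u] | u in [pred u | id u \in odflt [::] (output (x v))]].

Definition execution (x : nat -> configuration) : Prop :=
  x 0 = init_configuration /\ forall t, exists r : draws (x t), x t.+1 = round r.

Local Open Scope ring_scope.

(* Probability that, from [x], all vertices have halted after [T] rounds: the
   draws of a round are jointly uniform, hence independent across vertices, and
   independent of the past given the current configuration. *)
Fixpoint prob_halted_from (R : realType) (T : nat) (x : configuration) : R :=
  if T is T'.+1 then
    (\sum_(r : draws x) prob_halted_from R T' (round r)) / #|{: draws x}|%:R
  else (all_halted x)%:R.

Definition prob_halted (R : realType) (T : nat) : R :=
  prob_halted_from R T init_configuration.

End Execution.

Section Bounds.
Variables (R : realType) (V : finType) (G : cs_instance V).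
Local Open Scope ring_scope.

(* As usual inside O( ), the quantities are read as at least 1: the logarithms
   can vanish or be negative (e.g. when the client edges form a matching). The
   set V(C) is [cover (clients G)]. *)
Definition approx_bound : R :=
  Num.max 1 (Num.min (ln (#|clients G|%:R / #|cover (clients G)|%:R))
                     (ln (max_degree (servers G))%:R)).

Definition round_bound : R :=
  Num.max 1 (ln #|V|%:R * ln (max_degree (servers G))%:R).

End Bounds.

(* Main.v *)
(* The elements to cover are the ordered client pairs, by "stars": a center v with
   a set of server neighbours. A phase of the algorithm takes four rounds. Every
   vertex v takes as its level the largest k for which some star at v is
   2^k-dense, meaning that each leaf lies in at least 2^k uncovered pairs inside
   the star; the union of all 2^k-dense stars at v is 2^k-dense as well, and it
   can only shrink as pairs get covered. This canonical star is proposed with a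
   random ticket. Each uncovered pair votes for the earliest ticket among the
   proposals of maximal level that cover it, and a star is bought if it gets at
   least 1/8 of the votes of the pairs it covers.

   Size: a pair covered by a star of level k is charged 8 / 2^k. As k is maximal
   around the pair, the star of the optimum that covers the pair has density
   O(2^k), so the charges inside one star of the optimum form a truncated
   harmonic sum.

   Time: let K be the top level. Among the pairs of a canonical star of level K,
   those that are in many other such stars vote for this star together with a
   constant fraction of the rest, so in expectation the number of incidences
   between uncovered pairs and level-K stars drops by a constant factor. As the
   canonical stars of a level only shrink, the sum over k of (256 n^3)^k times
   the number of incidences at level k drops by a constant factor as well. *)
Require Import Defs.
From mathcomp Require Import all_boot all_order all_algebra.
From mathcomp Require Import zify lra.
From mathcomp Require Import reals exp.

Set Implicit Arguments.
Unset Strict Implicit.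
Unset Printing Implicit Defensive.

Import Order.TTheory GRing.Theory Num.Theory.

(** * Dense stars *)

Section DenseStars.
Variables (V : finType) (sv : V -> {set V}).
Implicit Types (U : {set V * V}) (v u w x : V) (X T : {set V}) (k : nat).

Definition within U X := [set p in U | (p.1 \in X) && (p.2 \in X)].

Definition links U X u := [set w in X | (u, w) \in U].

Definition dense U v k T :=
  (T \subset sv v) && [forall u in T, 2 ^ k <= #|links U (v |: T) u|].

Definition core U v k := \bigcup_(T | dense U v k T) T.

Definition spanned U v k := within U (v |: core U v k).

(** For irreflexive [U], [core_card] shows that the range of [k] loses nothing. An empty maximum is
    0, so level 0 does not promise a non-empty core. *)
Definition level U v := \max_(k < #|sv v|.+1 | core U v k != set0) k.

Lemma linksS U U' X X' u :
  U \subset U' -> X \subset X' -> links U X u \subset links U' X' u.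
Proof.
move=> /subsetP sU /subsetP sX; apply/subsetP => w; rewrite !inE.
by move=> /andP[/sX-> /sU->].
Qed.

Lemma withinS U U' X X' :
  U \subset U' -> X \subset X' -> within U X \subset within U' X'.
Proof.
move=> /subsetP sU /subsetP sX; apply/subsetP => w; rewrite !inE.
by move=> /and3P[/sU-> /sX-> /sX->].
Qed.

Lemma within_sub U X : within U X \subset U.
Proof. by apply/subsetP => p; rewrite inE => /andP[]. Qed.

Lemma denseP U v k T :
  reflect (T \subset sv v /\ forall u, u \in T -> 2 ^ k <= #|links U (v |: T) u|)
          (dense U v k T).
Proof.
apply: (iffP andP) => [[sT /forall_inP dT] | [sT dT]]; first by [].
by split=> //; apply/forall_inP.
Qed.

Lemma dense_core U v k T : dense U v k T -> T \subset core U v k.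
Proof. exact: bigcup_sup. Qed.

Lemma core_dense U v k : dense U v k (core U v k).
Proof.
apply/denseP; split=> [|u /bigcupP[T dT uT]].
  by apply/bigcupsP => T /denseP[].
have /denseP[_ /(_ u uT) le_k] := dT.
apply: leq_trans le_k (subset_leq_card (linksS _ _ _)) => //.
exact/setUS/dense_core.
Qed.

Lemma core_sub U v k : core U v k \subset sv v.
Proof. by have /denseP[] := core_dense U v k. Qed.

Lemma coreS U U' v k : U \subset U' -> core U v k \subset core U' v k.
Proof.
move=> sU; apply: dense_core; have /denseP[sT dT] := core_dense U v k.
apply/denseP; split=> // u uT; apply: leq_trans (dT u uT) _.
exact/subset_leq_card/linksS.
Qed.

Lemma spannedS U U' v k : U \subset U' -> spanned U v k \subset spanned U' v k.
Proof. by move=> sU; apply: withinS => //; apply/setUS/coreS. Qed.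

Lemma core_mem U v k u :
  u \in core U v k -> exists2 w, (u, w) \in U & w \in v |: core U v k.
Proof.
move=> uT; have /denseP[_ /(_ u uT)] := core_dense U v k.
have [->|[w]] := set_0Vmem (links U (v |: core U v k) u).
  by rewrite cards0 leqn0 expn_eq0.
by rewrite inE => /andP[wX uw] _; exists w.
Qed.

Lemma sum_links U X (A : {set V}) :
  A \subset X -> \sum_(u in A) #|links U X u| <= #|within U X|.
Proof.
move=> sAX; under eq_bigr => u _ do rewrite -sum1_card.
rewrite pair_big_dep /= sum1dep_card; apply/subset_leq_card/subsetP => -[u w].
by rewrite !inE /= => /and3P[/(subsetP sAX)-> -> ->].
Qed.

(** The pairs whose first end is a leaf already suffice. *)
Lemma card_spanned_ge U v k : 2 ^ k * #|core U v k| <= #|spanned U v k|.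
Proof.
have /denseP[_ dT] := core_dense U v k.
apply: leq_trans (sum_links U (subsetUr [set v] (core U v k))).
by rewrite mulnC -sum_nat_const; apply: leq_sum.
Qed.

Definition irreflexive_pairs U := forall u, (u, u) \notin U.
Definition symmetric_pairs U := forall u w, ((u, w) \in U) = ((w, u) \in U).

Lemma card_within U X :
  irreflexive_pairs U -> #|within U X| + #|X| <= #|X| * #|X|.
Proof.
move=> irrU; have diag_inj : injective (fun u : V => (u, u)) by move=> u w [].
rewrite -cardsX -(card_imset X diag_inj).
rewrite -cardsUI [_ :&: _](_ : _ = set0) ?cards0 ?addn0.
  apply/subset_leq_card/subsetP => -[u w]; rewrite in_setU in_setX.
  by case/orP => [|/imsetP[x xX [-> ->]]]; [rewrite inE => /and3P[_ -> ->] | rewrite xX].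
apply/setP => -[u w]; rewrite !inE /=; apply/negP => /andP[/and3P[uw _ _]].
by case/imsetP=> x _ [eu ew]; move: uw; rewrite eu ew; apply/negP/irrU.
Qed.

Lemma card_star U v T :
  irreflexive_pairs U -> #|within U (v |: T)| <= #|T| * #|T|.+1.
Proof.
move=> irrU; have := card_within (v |: T) irrU.
have: #|v |: T| <= #|T|.+1 by rewrite cardsU1; case: (v \notin T).
move: #|within _ _| #|_ |: _| #|T| => a b c; nia.
Qed.

Hypothesis sv_irr : forall v, v \notin sv v.

(** A leaf is not linked to itself, so its links lie among the other vertices of the star, and there
    are as many of these as leaves. *)
Lemma core_card U v k :
  irreflexive_pairs U -> core U v k != set0 -> 2 ^ k <= #|sv v|.
Proof.
move=> irrU /set0Pn[u uT]; have /denseP[sT /(_ u uT) le_k] := core_dense U v k.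
apply: leq_trans le_k (leq_trans _ (subset_leq_card sT)).
have vT : v \notin core U v k by apply: contra (sv_irr v); apply/subsetP.
have : u |: links U (v |: core U v k) u \subset v |: core U v k.
  by apply/subsetP => w; rewrite !inE => /orP[/eqP-> | /andP[]//]; rewrite uT orbT.
move/subset_leq_card; rewrite !cardsU1 vT inE.
by rewrite (negbTE (irrU u)) andbF /= !add1n ltnS.
Qed.

Lemma core_le_level U v k :
  irreflexive_pairs U -> core U v k != set0 -> k <= level U v.
Proof.
move=> irrU cU; have k_lt : k < #|sv v|.+1.
  by rewrite ltnS; apply: leq_trans (core_card irrU cU); apply/ltnW/ltn_expl.
by rewrite /level (bigD1 (Ordinal k_lt)) //= leq_maxl.
Qed.

Lemma level_core U v : 0 < level U v -> core U v (level U v) != set0.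
Proof.
rewrite /level => lv_gt0.
pose P (k : 'I_#|sv v|.+1) := core U v k != set0.
have [|k] := @eq_bigmax_cond _ P (@nat_of_ord _).
  apply/card_gt0P; case: (pickP P) => [k Pk | P0]; first by exists k.
  by rewrite big_pred0 // in lv_gt0.
by rewrite unfold_in => Pk ->.
Qed.

Lemma level_card U v : irreflexive_pairs U -> 0 < level U v -> 2 ^ level U v <= #|sv v|.
Proof. by move=> irrU /level_core; apply: core_card. Qed.

(* Remove leaves of degree below [2 ^ k] one by one: an ordered pair and its
   reverse disappear together, whence the factor 2. *)
Lemma within_small U v k T :
    irreflexive_pairs U -> symmetric_pairs U -> core U v k = set0 ->
  T \subset sv v -> #|within U (v |: T)| <= 2 * 2 ^ k * #|T|.
Proof.
move=> irrU symU core0; have [n leT] := ubnP #|T|.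
elim: n => // n IHn in T leT *; move=> sT.
have [->|[t0 Tt0]] := set_0Vmem T.
  rewrite setU0 cards0 muln0 leqn0 cards_eq0; apply/eqP/setP => -[u w].
  rewrite !inE /=; apply/negP => /and3P[uw /eqP eu /eqP ew].
  by move: uw; rewrite eu ew; apply/negP/irrU.
(* Otherwise [T] would be dense and hence contained in the empty core. *)
have /existsP[t] : [exists t in T, #|links U (v |: T) t| < 2 ^ k].
  apply: contraT; rewrite negb_exists => /forallP dT.
  have : T \subset core U v k.
    apply/dense_core/denseP; split=> // u uT.
    by move: (dT u); rewrite uT -leqNgt.
  by rewrite core0 subset0 => /eqP T0; rewrite T0 inE in Tt0.
case/andP => tT lt_t.
have {}IHn : #|within U (v |: T :\ t)| <= 2 * 2 ^ k * #|T :\ t|.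
  apply: IHn; first by rewrite (cardsD1 t T) tT in leT; rewrite -ltnS.
  exact: subset_trans (subsetDl _ _) sT.
have tv : t != v by apply: contraNneq (sv_irr v) => {1}<-; apply: (subsetP sT).
have sW : within U (v |: T) \subset within U (v |: T :\ t)
    :|: ([set (t, w) | w in links U (v |: T) t]
    :|: [set (w, t) | w in links U (v |: T) t]).
  apply/subsetP => -[u w]; rewrite in_set => /and3P[/= uw uX wX].
  rewrite !in_setU; have [eu|ne_u] := eqVneq u t.
    rewrite -eu; apply/orP; right; apply/orP; left.
    by apply/imset_f; rewrite in_set uw wX.
  have [ew|ne_w] := eqVneq w t.
    rewrite -ew; apply/orP; right; apply/orP; right.
    by apply: (imset_f (fun x => (x, w))); rewrite in_set symU uX.
  by rewrite !inE /= in uX wX *; rewrite uw ne_u ne_w uX wX.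
rewrite (cardsD1 t T) tT.
have := leq_trans (subset_leq_card sW) (leq_card_setU _ _).
have [+ _] := leq_card_setU [set (t, w) | w in links U (v |: T) t]
                            [set (w, t) | w in links U (v |: T) t].
have := leq_imset_card (fun w => (t, w)) (links U (v |: T) t).
have := leq_imset_card (fun w => (w, t)) (links U (v |: T) t).
move: IHn lt_t; rewrite mulnDr muln1.
move: (#|T :\ t|) (2 ^ k) (#|links _ _ _|) (#|within U (v |: T)|) => n1 n2 n3 n4.
move: (#|within _ _|) => n5.
move: #|_ :|: _| => n6. move: #|[set _ | _ in _]| => n7.
move: #|[set _ | _ in _]| => n8. lia.
Qed.

End DenseStars.

(** * Voting and one phase of the algorithm *)

(** Lexicographic order on ticket and ID; the ID breaks ties, so that the earliest proposal is
    unique. *)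
Definition earlier (a b : rat * nat) : bool :=
  (a.1 < b.1)%R || ((a.1 == b.1) && (a.2 <= b.2)).

Lemma earlier_refl : reflexive earlier.
Proof. by move=> a; rewrite /earlier eqxx leqnn orbT. Qed.

Lemma earlier_total : total earlier.
Proof.
move=> a b; rewrite /earlier; case: ltgtP => //= _.
by rewrite leq_total.
Qed.

Lemma earlier_trans : transitive earlier.
Proof.
move=> b a c /orP[ab | /andP[/eqP ab ab2]] /orP[bc | /andP[/eqP bc bc2]];
  rewrite /earlier.
- by rewrite (lt_trans ab bc).
- by rewrite -bc ab.
- by rewrite ab bc.
- by rewrite ab bc eqxx (leq_trans ab2 bc2) orbT.
Qed.

Lemma earlier_anti a b : earlier a b -> earlier b a -> a = b.
Proof.
rewrite /earlier [b.1 == _]eq_sym; case: ltgtP => //= ab le_ab le_ba.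
by rewrite [a]surjective_pairing [b]surjective_pairing ab (@anti_leq a.2 b.2) ?le_ab.
Qed.

Lemma exists_earliest (V : finType) (key : V -> rat * nat) (P : pred V) v0 :
  P v0 -> exists2 v, P v & forall w, P w -> earlier (key v) (key w).
Proof.
move=> Pv0.
case: (@extremumP _ V earlier v0 P key earlier_refl earlier_trans earlier_total Pv0).
by move=> v; exists v.
Qed.

Section Voting.
(* [N v] is the closed neighbourhood of [v] in the communication graph. *)
Variables (V : finType) (sv N : V -> {set V}) (id : V -> nat).
Implicit Types (U : {set V * V}) (p : V * V) (t : V -> rat).
Implicit Types (v u w x y : V) (X T : {set V}) (k : nat).

Definition top U u := \max_(x in N u) level sv U x.

(** The first end of an ordered pair decides alone, so a pair and its reverse may vote for different
    stars. *)
Definition cand U p x :=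
  [&& x \in N p.1, level sv U x == top U p.1 & p \in spanned sv U x (level sv U x)].

Definition votes_for U t p x :=
  cand U p x && [forall y, cand U p y ==> earlier (t x, id x) (t y, id y)].

Definition votes U t x := [set p in U | votes_for U t p x].

Definition wins U t x := #|spanned sv U x (level sv U x)| <= 8 * #|votes U t x|.

Definition won U t x := if wins U t x then core sv U x (level sv U x) else set0.

(** Pairs inside a bought star count as covered whatever they voted for. *)
Definition step U t := U :\: \bigcup_x within U (x |: won U t x).

Hypothesis sv_irr : forall v, v \notin sv v.
Hypothesis id_inj : injective id.
Hypothesis NC : forall u v, (u \in N v) = (v \in N u).
Hypothesis svN : forall v, v |: sv v \subset N v.

Lemma step_sub U t : step U t \subset U.
Proof. exact: subsetDl. Qed.

Lemma symmetric_step U t : symmetric_pairs U -> symmetric_pairs (step U t).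
Proof.
move=> symU u w; rewrite !inE symU; congr (~~ _ && _).
apply/bigcupP/bigcupP => -[x _]; rewrite !inE => /and3P[/= uw uX wX];
  by exists x => //; rewrite !inE /= symU uw uX wX.
Qed.

Lemma irreflexive_sub U U' :
  U' \subset U -> irreflexive_pairs U -> irreflexive_pairs U'.
Proof. by move=> /subsetP sU irrU u; apply: contra (irrU u); apply: sU. Qed.

Lemma votes_for_inj U t p x y : votes_for U t p x -> votes_for U t p y -> x = y.
Proof.
move=> /andP[cx /forall_inP ex] /andP[cy /forall_inP ey].
by have [_ /id_inj] := earlier_anti (ex y cy) (ey x cx).
Qed.

Lemma cand_votes U t p x : cand U p x -> exists y, votes_for U t p y.
Proof.
move=> cx; have [y cy ey] := @exists_earliest V (fun y => (t y, id y)) (cand U p) x cx.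
by exists y; rewrite /votes_for cy; apply/forall_inP.
Qed.

Lemma wins_notin_step U t p x : votes_for U t p x -> wins U t x -> p \notin step U t.
Proof.
case/andP => /and3P[_ _ px] _ wx; rewrite inE negb_and negbK; apply/orP; left.
by apply/bigcupP; exists x => //; rewrite /won wx.
Qed.

(** For [k = 0] one link per leaf is enough. By symmetry both ends of a link qualify, so dropping
    the leaves without links loses no pair. *)
Lemma spanned0 U p x :
  symmetric_pairs U -> p \in within U (x |: sv x) -> p \in spanned sv U x 0.
Proof.
move=> symU pX; pose T := [set u in sv x | links U (x |: sv x) u != set0].
have dT : dense sv U x 0 T.
  apply/denseP; split=> [|u]; first by apply/subsetP => u; rewrite inE => /andP[].
  rewrite inE => /andP[ux /set0Pn[w]]; rewrite inE => /andP[wX uw].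
  rewrite expn0 card_gt0; apply/set0Pn; exists w.
  rewrite inE uw andbT in_setU1; case/setU1P: wX => [->|wx]; first by rewrite eqxx.
  rewrite inE wx; apply/orP; right; apply/set0Pn; exists u.
  by rewrite inE -symU uw andbT in_setU1 ux orbT.
apply: (subsetP (withinS (subxx U) (setUS [set x] (dense_core dT)))).
move: pX; rewrite inE => /and3P[uw uX wX]; rewrite inE uw /=.
apply/andP; split.
  case/setU1P: (uX) => [->|ux]; first by rewrite setU11.
  by rewrite in_setU1 inE ux; apply/orP; right; apply/set0Pn; exists p.2; rewrite inE wX -surjective_pairing.
case/setU1P: (wX) => [->|wx]; first by rewrite setU11.
rewrite in_setU1 inE wx; apply/orP; right; apply/set0Pn; exists p.1.
by rewrite inE uX symU -surjective_pairing.
Qed.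

Lemma spanned_core_neq0 U x k : irreflexive_pairs U -> spanned sv U x k != set0 ->
  core sv U x k != set0.
Proof.
move=> irrU; apply: contra_neq => c0; apply/setP => -[u w].
rewrite inE c0 setU0 !inE /=; apply/negP => /and3P[uw /eqP eu /eqP ew].
by move: uw; rewrite eu ew; apply/negP/irrU.
Qed.

Section TopLevel.
Variables (U : {set V * V}) (K : nat).
Hypothesis irrU : irreflexive_pairs U.
Hypothesis level_le : forall x, level sv U x <= K.

Lemma spanned_level x : spanned sv U x K != set0 -> level sv U x = K.
Proof.
move=> /(spanned_core_neq0 irrU)/(core_le_level sv_irr irrU) le_K.
by apply/eqP; rewrite eqn_leq level_le.
Qed.

Lemma spanned_nbr p x k : p \in spanned sv U x k -> x \in N p.1.
Proof.
rewrite inE => /and3P[_ px _]; rewrite NC; apply: (subsetP (svN x)).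
by apply: (subsetP (setUS _ (core_sub _ _ _ _))) px.
Qed.

Lemma top_eq p x : p \in spanned sv U x K -> top U p.1 = K.
Proof.
move=> px; apply/eqP; rewrite eqn_leq; apply/andP; split.
  by apply/bigmax_leqP.
have {1}<- : level sv U x = K by apply: spanned_level; apply/set0Pn; exists p.
by apply: leq_bigmax_cond; apply: spanned_nbr px.
Qed.

(** A pair inside some star of the globally maximal level sees [K] as its local maximum, so its
    candidates are exactly the level-[K] stars that span it. *)
Lemma candE p x y : p \in spanned sv U x K ->
  cand U p y = (p \in spanned sv U y K).
Proof.
move=> px; apply/idP/idP => [/and3P[_ /eqP ly]|py].
  by rewrite ly (top_eq px).
have ly : level sv U y = K by apply: spanned_level; apply/set0Pn; exists p.
by rewrite /cand (spanned_nbr py) ly (top_eq px) eqxx.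
Qed.

End TopLevel.

(** The globally earliest proposal among the stars of maximal level receives the votes of all pairs
    it spans, so it wins. This progress is certain, for arbitrary tickets, and is what makes every
    execution terminate. *)
Lemma step_proper U t :
    irreflexive_pairs U -> symmetric_pairs U -> U != set0 ->
    (forall p, p \in U -> exists x, p \in within U (x |: sv x)) ->
  step U t \proper U.
Proof.
move=> irrU symU /set0Pn[p0 Up0] feasU.
pose K := \max_x level sv U x.
have leK x : level sv U x <= K by apply: leq_bigmax.
have [v0 Pv0] : exists v, spanned sv U v K != set0.
  have [x0 /(spanned0 symU) px0] := feasU p0 Up0.
  (* A maximal level of 0 gives no non-empty star by itself; [spanned0] supplies one. *)
  have [K0 | K_gt0] := posnP K.
    by exists x0; rewrite K0; apply/set0Pn; exists p0.
  have [|x _ Kx] := @eq_bigmax_cond _ (mem V) (level sv U).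
    by apply/card_gt0P; exists x0.
  have {}Kx : level sv U x = K by rewrite -Kx; apply: eq_bigl.
  have cx : core sv U x K != set0 by rewrite -Kx level_core ?Kx.
  exists x; rewrite -card_gt0; apply: leq_trans (card_spanned_ge _ _ _ _).
  by rewrite muln_gt0 expn_gt0 /= card_gt0.
have [v /= Pv ev] := @exists_earliest V (fun y => (t y, id y))
                    (fun v => spanned sv U v K != set0) v0 Pv0.
have lv := spanned_level irrU leK Pv.
have vv p : p \in spanned sv U v K -> votes_for U t p v.
  move=> pv; rewrite /votes_for (candE irrU leK v pv) pv; apply/forall_inP => y.
  by rewrite (candE irrU leK y pv) => py; apply: ev; apply/set0Pn; exists p.
have wv : wins U t v.
  rewrite /wins lv; apply: leq_trans (leq_pmull _ (isT : 0 < 8)).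
  apply/subset_leq_card/subsetP => p pv; rewrite inE vv // andbT.
  exact: (subsetP (within_sub _ _) _ pv).
have [p pv] := set0Pn _ Pv; apply/properP; split; first exact: step_sub.
exists p; first exact: (subsetP (within_sub _ _) _ pv).
exact: wins_notin_step (vv p pv) wv.
Qed.

(* If all server degrees are at most 1 then a star spans at most two ordered
   pairs, so that a single vote is enough to win. *)
Lemma step_matching U t :
    irreflexive_pairs U -> symmetric_pairs U ->
    (forall p, p \in U -> exists x, p \in within U (x |: sv x)) ->
    (forall v, #|sv v| <= 1) ->
  step U t = set0.
Proof.
move=> irrU symU feasU sv1.
have l0 x : level sv U x = 0.
  apply/eqP; rewrite -leqn0 leqNgt; apply/negP => l_gt0.
  have := leq_trans (level_card sv_irr irrU l_gt0) (sv1 x).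
  by rewrite leqNgt -{1}[1](expn0 2) ltn_exp2l // l_gt0.
apply/eqP; rewrite -subset0; apply/subsetP => p pS.
have [x /(spanned0 symU) px] := feasU p (subsetP (step_sub U t) p pS).
have leK y : level sv U y <= 0 by rewrite l0.
have [|y vy] := @cand_votes U t p x; first by rewrite (candE irrU leK x px).
have Up : p \in U by apply: (subsetP (step_sub U t)).
suff wy : wins U t y by rewrite (negbTE (wins_notin_step vy wy)) in pS.
have: 0 < #|votes U t y| by apply/card_gt0P; exists p; rewrite inE Up.
rewrite /wins; suff: #|spanned sv U y (level sv U y)| <= 2 by lia.
apply: leq_trans (card_star _ _ irrU) _.
have := leq_trans (subset_leq_card (core_sub sv U y (level sv U y))) (sv1 y).
by case: #|_| => [|[]].
Qed.

End Voting.

(** * Drift of the potential in one phase *)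

Lemma card_ord_lt n m : m <= n -> #|[pred i : 'I_n | i < m]| = m.
Proof.
by move=> le_mn; rewrite -sum1_card -(big_ord_widen n (fun=> 1) le_mn) sum1_card card_ord.
Qed.

(** * Random tickets and the probability that they are low *)

Section Draws.
Variables (V : finType) (bnd : V -> nat).
Local Notation draw := {dffun forall v : V, 'I_(bnd v).+1}.
Implicit Types (v u : V) (r : draw) (d : nat) (S : {set V}).

(** Dividing by the size of the range makes draws of vertices with different ranges comparable. *)
Definition ticket r v : rat := ((r v).+1%:R / (bnd v).+1%:R)%R.

(* The ticket of v is at most 1 / (4 d). This has probability at most 1 / (4 d),
   and at least 1 / (8 d) if the range of the draw allows it. *)
Definition low d v (i : 'I_(bnd v).+1) := i.+1 * (4 * d) <= (bnd v).+1.

Lemma card_low d v : 0 < d -> #|[pred i | low d (v := v) i]| = (bnd v).+1 %/ (4 * d).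
Proof.
move=> d_gt0; have d4 : 0 < 4 * d by rewrite muln_gt0.
rewrite -(@card_ord_lt (bnd v).+1 (_ %/ _)) ?leq_div //.
by apply: eq_card => i; rewrite !inE /low leq_divRL.
Qed.

Lemma lowE d r v : low d (r v) = (ticket r v * (4 * d)%:R <= 1)%R.
Proof.
rewrite /low /ticket mulrAC ler_pdivrMr ?ltr0n // mul1r -natrM ler_nat.
by [].
Qed.

Lemma low_earlier d r v u :
  low d (r v) -> ~~ low d (r u) -> (ticket r v < ticket r u)%R.
Proof.
rewrite !lowE -ltNge => lv lu; have := le_lt_trans lv lu.
case: d {lv lu} => [|d]; first by rewrite !mulr0 ltxx.
by rewrite ltr_pM2r // ltr0n.
Qed.

Definition all_low d S := [set r : draw | [forall v in S, low d (r v)]].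

Definition cells d S v := if v \in S then (bnd v).+1 %/ (4 * d) else (bnd v).+1.

Lemma card_all_low d S : 0 < d -> #|all_low d S| = \prod_v cells d S v.
Proof.
move=> d_gt0; pose F v := [pred i : 'I_(bnd v).+1 | (v \in S) ==> low d i].
have -> : #|all_low d S| = #|(family F : simpl_pred draw)|.
  by apply: eq_card => r; rewrite !inE; apply: eq_forallb => v; rewrite inE.
rewrite card_family foldrE big_map enumT /=; apply: eq_bigr => v _; rewrite /cells.
rewrite /F /=; case: (v \in S) => /=; first by rewrite -card_low.
by rewrite -[RHS]card_ord.
Qed.

Lemma card_draws : #|{: draw}| = \prod_v (bnd v).+1.
Proof.
rewrite card_dep_ffun foldrE big_map enumT /=; apply: eq_bigr => v _.
exact: card_ord.
Qed.

(** Independence of the draws: one more low ticket costs a factor [4 * d], for any range, because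
    the count of low values is rounded down. *)
Lemma all_lowU1 d S u : 0 < d -> u \notin S ->
  4 * d * #|all_low d (u |: S)| <= #|all_low d S|.
Proof.
move=> d_gt0 uS; rewrite !card_all_low // (bigD1 u) //= [X in _ <= X](bigD1 u) //= /cells setU11 (negbTE uS).
rewrite mulnA; apply: leq_mul; first by rewrite mulnC leq_divM.
by apply: leq_prod => v /negbTE ne_v; rewrite in_setU1 ne_v.
Qed.

(** Rounding down loses at most a factor 2 once the quotient is at least 1, whence 8 in place of
    4. *)
Lemma draws_le_low d v : 0 < d -> 4 * d <= (bnd v).+1 ->
  #|{: draw}| <= 8 * d * #|all_low d [set v]|.
Proof.
move=> d_gt0 le_d; rewrite card_draws card_all_low // (bigD1 v) //= [X in _ <= _ * X](bigD1 v) //= /cells set11.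
rewrite mulnA; apply: leq_mul.
  have := ltn_ceil (bnd v).+1 (_ : 0 < 4 * d); have := divn_gt0 (bnd v).+1 (_ : 0 < 4 * d).
  rewrite le_d; move: (_ %/ _) => q; rewrite !muln_gt0 d_gt0 => /(_ isT) q0 /(_ isT).
  move: q0; move: (bnd v).+1 => b; nia.
by apply: leq_prod => u /negbTE ne_u; rewrite inE ne_u.
Qed.

End Draws.

(** * Expected drop of the number of incidences at the top level *)

Section Drift.
Variables (V : finType) (sv N : V -> {set V}) (id : V -> nat) (bnd : V -> nat).
Local Notation draw := {dffun forall v : V, 'I_(bnd v).+1}.
Hypothesis sv_irr : forall v, v \notin sv v.
Hypothesis id_inj : injective id.
Hypothesis NC : forall u v, (u \in N v) = (v \in N u).
Hypothesis svN : forall v, v |: sv v \subset N v.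

Variables (U : {set V * V}) (K : nat).
Hypothesis irrU : irreflexive_pairs U.
Hypothesis level_le : forall x, level sv U x <= K.

Definition centers (p : V * V) := [set v | p \in spanned sv U v K].
Local Notation deg p := (#|centers p|).

Hypothesis bnd_large : forall v p, p \in spanned sv U v K -> 4 * deg p <= (bnd v).+1.

Implicit Types (v u : V) (p q : V * V) (r : draw).

Local Notation vote r p v := (votes_for sv N id U (ticket r) p v).
Local Notation win r v := (wins sv N id U (ticket r) v).

Lemma deg_gt0 p v : p \in spanned sv U v K -> 0 < deg p.
Proof. by move=> pv; apply/card_gt0P; exists v; rewrite inE. Qed.

(** A low ticket precedes every ticket that is not low, so the only low one among the centers of [p]
    gets its vote. *)
Lemma vote_low d p v r :
    p \in spanned sv U v K -> low d (r v) ->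
    (forall u, u \in centers p -> u != v -> ~~ low d (r u)) ->
  vote r p v.
Proof.
move=> pv lv lN; rewrite /votes_for (candE sv_irr NC svN irrU level_le v pv) pv.
apply/forall_inP => u; rewrite (candE sv_irr NC svN irrU level_le u pv) => pu.
have [->|ne_u] := eqVneq u v; first exact: earlier_refl.
by rewrite /earlier /= (low_earlier lv) // lN // inE.
Qed.

(* At most 2 d centers span p or q. By pairwise independence, if v has a low
   ticket then with probability at least 1/2 no other of them has one. *)
Lemma two_votes p q v :
    p \in spanned sv U v K -> q \in spanned sv U v K -> deg q <= deg p ->
  #|all_low bnd (deg p) [set v]| <=
    2 * #|[set r : draw | [&& low (deg p) (r v), vote r p v & vote r q v]]|.
Proof.
move=> pv qv; set d := deg p => le_d; set A := all_low _ _ _; set G := [set r | _].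
have d_gt0 : 0 < d := deg_gt0 pv.
pose M := (centers p :|: centers q) :\ v.
have sA : A \subset G :|: \bigcup_(u in M) all_low bnd d (u |: [set v]).
  apply/subsetP => r; rewrite inE => /forall_inP/(_ v (set11 v)) lv.
  have [/exists_inP[u uM lu] | noM] := boolP [exists u in M, low d (r u)].
    rewrite inE; apply/orP; right; apply/bigcupP; exists u => //; rewrite inE.
    by apply/forall_inP => w /setU1P[-> | /set1P->].
  have {}noM u : u \in centers p :|: centers q -> u != v -> ~~ low d (r u).
    move=> upq ne_u; apply: contra noM => lu; apply/exists_inP; exists u => //.
    by rewrite in_setD1 ne_u.
  rewrite in_setU in_set lv !(vote_low (d := d)) // => u us; apply: noM.
    by rewrite in_setU us orbT.
  by rewrite in_setU us.
have leM : #|M| <= 2 * d.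
  apply: leq_trans (subset_leq_card (subsetDl _ _)) _.
  apply: leq_trans (leq_card_setU _ _) _; rewrite mul2n -addnn.
  exact: leq_add.
(* Union bound: at most [2 * d] rivals, each of them low in at most a fraction [1 / (4 * d)] of the
   draws in [A]. *)
have le_cup : 4 * d * #|\bigcup_(u in M) all_low bnd d (u |: [set v])| <= 2 * d * #|A|.
  apply: leq_trans (_ : #|M| * #|A| <= _); last by rewrite leq_mul2r leM orbT.
  rewrite -sum_nat_const.
  have: #|\bigcup_(u in M) all_low bnd d (u |: [set v])|
         <= \sum_(u in M) #|all_low bnd d (u |: [set v])|.
    elim/big_rec2: _ => [|u S n _ IH]; first by rewrite cards0.
    exact: leq_trans (leq_card_setU _ _) (leq_add _ IH).
  rewrite -(leq_pmul2l (_ : 0 < 4 * d)) ?muln_gt0 //; move/leq_trans; apply.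
  rewrite big_distrr; apply: leq_sum => u; rewrite !inE => /andP[ne_u _].
  by apply: all_lowU1; rewrite ?inE.
have := leq_trans (subset_leq_card sA) (leq_card_setU _ _).
move: le_cup; move: #|A| #|G| (#|\bigcup_(_ in _) _|) => a g m; nia.
Qed.

(** The pairs of the star whose degree is at least a median degree: at least half of the star is not
    more contested than [p]. *)
Definition half_top v :=
  [set p in spanned sv U v K |
    #|spanned sv U v K| <= 2 * #|[set q in spanned sv U v K | deg q <= deg p]|].

(** Let [z] have maximal degree among the pairs outside. All outside pairs have at most its degree,
    and [z] fails the median test, so they are fewer than half of the star. *)
Lemma card_half_top v : #|spanned sv U v K| <= 2 * #|half_top v|.
Proof.
set C := spanned _ _ _ _; set Z := C :\: half_top v.
have [Z0|[z0 z0Z]] := set_0Vmem Z.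
  have sC : C \subset half_top v by rewrite -setD_eq0 -/Z Z0.
  by have := subset_leq_card sC; lia.
have [z zZ zmax] := @arg_maxnP _ z0 (fun p => p \in Z) (fun p => deg p) z0Z.
have zC : z \in C by move: zZ; rewrite inE => /andP[].
have sZ : Z \subset [set q in C | deg q <= deg z].
  apply/subsetP => q qZ; rewrite inE; apply/andP; split; last exact: zmax.
  by move: qZ; rewrite inE => /andP[].
have := subset_leq_card sZ; move: zZ.
rewrite in_setD in_set zC -ltnNge /= andbT.
have sT : half_top v \subset C by apply/subsetP => q; rewrite inE => /andP[].
rewrite -(cardsID (half_top v) C) -/Z (setIidPr sT).
move: #|half_top v| #|Z| #|[set q in C | _]| => a b c; lia.
Qed.

(** The ticket of [v] is low with probability at least [1 / (8 * d)]. In that event the pairs of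
    [Lo] vote for [v] together with [p] often enough that [v] wins, along with the vote of [p], in
    at least a quarter of the cases. *)
Lemma win_likely p v : p \in half_top v ->
  #|{: draw}| <= 32 * deg p * #|[set r : draw | vote r p v && win r v]|.
Proof.
rewrite inE => /andP[pv]; set d := #|centers p|.
set Lo := [set q in _ | _]; set Z := [set r | _] => le_Lo.
have d_gt0 : 0 < d := deg_gt0 pv.
have le_N := draws_le_low d_gt0 (bnd_large pv).
pose A := all_low bnd d [set v].
pose Y := [set r : draw | low d (r v) && vote r p v].
pose hits r := #|[set q in Lo | vote r q v]|.
have Lo_gt0 : 0 < #|Lo| by apply/card_gt0P; exists p; rewrite inE pv /=.
(* Double counting: [two_votes] is applied to each [q] in [Lo]. *)
have lb : #|Lo| * #|A| <= 2 * \sum_(r in Y) hits r.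
  have -> : \sum_(r in Y) hits r =
      \sum_(q in Lo) #|[set r : draw | [&& low d (r v), vote r p v & vote r q v]]|.
    under eq_bigr => r _ do rewrite /hits -sum1dep_card big_mkcondr.
    rewrite exchange_big; apply: eq_bigr => q _.
    rewrite -big_mkcondr -sum1dep_card; apply: eq_bigl => r.
    by rewrite inE andbA.
  rewrite -sum_nat_const big_distrr; apply: leq_sum => q; rewrite inE => /andP[qv].
  exact: two_votes.
(* If [v] loses, its votes are less than an eighth of its star, so [hits r] is less than a quarter
   of [Lo]. Otherwise [hits r] is at most [#|Lo|] and the draw lies in [Z]. *)
have ub : 4 * (\sum_(r in Y) hits r) <= 4 * #|Lo| * #|Z| + #|Lo| * #|A|.
  apply: leq_trans (_ : \sum_(r in Y) (4 * #|Lo| * (r \in Z) + #|Lo|) <= _).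
    rewrite big_distrr; apply: leq_sum => r; rewrite inE => /andP[_ pr].
    have hL : hits r <= #|Lo|.
      by apply/subset_leq_card/subsetP => q; rewrite inE => /andP[].
    rewrite inE pr /=; have [_|] := boolP (win r v).
      by rewrite muln1 (leq_trans _ (leq_addr _ _)) // leq_mul2l hL.
    rewrite /wins -ltnNge (spanned_level sv_irr irrU level_le); last first.
      by apply/set0Pn; exists p.
    have: hits r <= #|votes sv N id U (ticket r) v|.
      apply/subset_leq_card/subsetP => q; rewrite inE => /andP[+ qv].
      by rewrite inE => /andP[qs _]; rewrite inE qv (subsetP (within_sub _ _) _ qs).
    move: le_Lo; rewrite muln0 add0n.
    by move: #|Lo| (hits r) #|votes _ _ _ _ _ _| #|spanned _ _ _ _| => a b c e; lia.
  rewrite big_split /= leq_add //.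
    rewrite -big_distrr leq_mul2l; apply/orP; right.
    rewrite -sum1_card [X in _ <= X]big_mkcond [X in X <= _]big_mkcond.
    by apply: leq_sum => r _; case: (r \in Y); case: (r \in Z).
  rewrite sum_nat_const mulnC leq_mul2l; apply/orP; right.
  apply/subset_leq_card/subsetP => r; rewrite inE => /andP[lr _]; rewrite inE.
  by apply/forall_inP => w /set1P->.
have leA : #|A| <= 4 * #|Z| by rewrite -(leq_pmul2l Lo_gt0); lia.
apply: leq_trans le_N _; rewrite -/A; move: leA.
by move: #|A| #|Z| => a z; nia.
Qed.

Definition weight (W : {set V * V}) k := \sum_v #|spanned sv W v k|.

(** A covered pair leaves all [deg p] stars that spanned it, and the stars only shrink. Pairs
    outside [U] have degree 0, so they do not disturb the sum. *)
Lemma weight_step r :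
  weight (step sv N id U (ticket r)) K
    + \sum_(p | p \notin step sv N id U (ticket r)) deg p <= weight U K.
Proof.
set U' := step _ _ _ _ _.
have -> : \sum_(p | p \notin U') deg p = \sum_v #|spanned sv U v K :\: U'|.
  under eq_bigr => p _ do rewrite -sum1dep_card.
  rewrite (exchange_big_dep predT) //=; apply: eq_bigr => v _; rewrite -sum1_card.
  by apply: eq_bigl => p; rewrite in_setD.
rewrite -big_split; apply: leq_sum => v _ /=.
rewrite -(cardsID U' (spanned sv U v K)) leq_add2r.
apply/subset_leq_card/subsetP => p pU'; rewrite inE.
rewrite (subsetP (spannedS _ _ _ (step_sub _ _ _ _ _)) _ pU').
exact: (subsetP (within_sub _ _) _ pU').
Qed.

(** A pair votes for a single star, so the events of [win_likely] for different [v] are disjoint.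
    Their probabilities, weighted by [deg p], add up to a 1/32 of the incidences in [half_top],
    which are at least half of all. *)
Lemma sum_covered :
  #|{: draw}| * weight U K <=
    64 * \sum_(r : draw) \sum_(p | p \notin step sv N id U (ticket r)) deg p.
Proof.
have -> : \sum_(r : draw) \sum_(p | p \notin step sv N id U (ticket r)) deg p
   = \sum_p deg p * #|[set r : draw | p \notin step sv N id U (ticket r)]|.
  rewrite (exchange_big_dep predT) //=; apply: eq_bigr => p _.
  by rewrite sum_nat_cond_const mulnC; congr (_ * _); apply: eq_card => r; rewrite !inE.
apply: leq_trans (_ : 2 * \sum_p \sum_(v | p \in half_top v) #|{: draw}| <= _).
  rewrite (exchange_big_dep predT) //= mulnC big_distrl big_distrr /=.
  apply: leq_sum => v _; rewrite sum_nat_cond_const mulnA leq_mul2r.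
  by rewrite (eq_card (in_set (mem (half_top v)))) card_half_top orbT.
rewrite (_ : 64 = 2 * 32) // -mulnA leq_mul2l /= big_distrr; apply: leq_sum => p _.
apply: leq_trans (_ : \sum_(v | p \in half_top v)
   32 * deg p * #|[set r : draw | vote r p v && win r v]| <= _).
  by apply: leq_sum => v; apply: win_likely.
rewrite -big_distrr /= mulnA leq_mul2l; apply/orP; right.
under eq_bigr => v _ do rewrite -sum1dep_card.
rewrite (exchange_big_dep (fun r : draw => p \notin step sv N id U (ticket r))) /=.
  rewrite -sum1dep_card; apply: leq_sum => r _; rewrite sum1dep_card.
  rewrite -[X in _ <= X](cards1 p) -sum1_card.
  have [-> | [v0 v0P]] := set_0Vmem [set v | p \in half_top v & vote r p v && win r v].
    by rewrite sum1_card cards0.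
  rewrite sum1_card cards1 -(cards1 v0); apply/subset_leq_card/subsetP => v.
  move: v0P; rewrite !inE => /and3P[_ v0p _] /and3P[_ vp _].
  by apply/eqP; apply: votes_for_inj id_inj _ _ _ _ _ vp v0p.
by move=> v r _ /andP[vp vw]; apply: wins_notin_step vp vw.
Qed.

Lemma weight_drift :
  64 * (\sum_(r : draw) weight (step sv N id U (ticket r)) K)
    <= 63 * #|{: draw}| * weight U K.
Proof.
have := sum_covered.
have : \sum_(r : draw) (weight (step sv N id U (ticket r)) K
    + \sum_(p | p \notin step sv N id U (ticket r)) deg p) <= #|{: draw}| * weight U K.
  by rewrite -sum_nat_const; apply: leq_sum => r _; apply: weight_step.
rewrite big_split /=.
set a := \sum_r weight _ _; set b := \sum_r \sum_(_ | _) _; set c := #|_|; set e := weight _ _.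
by rewrite -mulnA; move: (c * e) a b => *; lia.
Qed.

End Drift.

(** In the induction, each of the old sum and the new term uses up at most half of
    [256 * m * w ^ k]. *)
Lemma geometric_sum_le m w k :
  0 < m -> 256 * m <= w -> 128 * m * (\sum_(j < k) w ^ j) <= w ^ k.
Proof.
move=> m_gt0 le_w; elim: k => [|k IHk]; first by rewrite big_ord0 muln0.
rewrite big_ord_recr /= mulnDr expnS.
have w_gt0 : 0 < w by apply: leq_trans le_w; rewrite muln_gt0.
have : 0 < w ^ k by rewrite expn_gt0 w_gt0.
move: IHk; move: (w ^ k) (\sum_(j < k) w ^ j) => a b; nia.
Qed.

(** * The potential that combines all levels *)

Section Potential.
Variables (V : finType) (sv N : V -> {set V}) (id : V -> nat).
Hypothesis sv_irr : forall v, v \notin sv v.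
Hypothesis id_inj : injective id.
Hypothesis NC : forall u v, (u \in N v) = (v \in N u).
Hypothesis svN : forall v, v |: sv v \subset N v.
Implicit Types (U : {set V * V}) (v u : V) (p : V * V).

(** [#|V| ^ 3] bounds the weight of any level (one center and one ordered pair), and 256 is the
    slack that [geometric_sum_le] asks for. *)
Definition base := 256 * #|V| ^ 3.

(* Under the weights [base ^ k], the total weight of all levels below the top
   one is negligible, so that a drop of the top level never increases the sum. *)
Definition potential L U := \sum_(k < L.+1) base ^ k * weight sv U k.

Lemma weight_le U k : weight sv U k <= #|V| ^ 3.
Proof.
rewrite /weight -[X in _ <= X]/(#|V| * (#|V| * #|V|)) -card_prod -sum_nat_const.
by apply: leq_sum => v _; apply: max_card.
Qed.

Lemma weightS U U' k : U \subset U' -> weight sv U k <= weight sv U' k.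
Proof. by move=> sU; apply: leq_sum => v _; apply/subset_leq_card/spannedS. Qed.

Lemma weight_eq0 U k : irreflexive_pairs U -> (forall v, level sv U v < k) -> weight sv U k = 0.
Proof.
move=> irrU lt_k; apply: big1 => v _; apply/eqP; rewrite cards_eq0; apply: contraT.
move=> /(spanned_core_neq0 irrU)/(core_le_level sv_irr irrU).
by rewrite leqNgt lt_k.
Qed.

Definition coverable U := forall p, p \in U -> exists x, p \in within U (x |: sv x).

(** Makes the top-level term of the potential at least [base ^ K], enough to dominate all lower
    levels. *)
Lemma weight_top U (K := \max_x level sv U x) :
  symmetric_pairs U -> coverable U -> U != set0 -> 0 < weight sv U K.
Proof.
move=> symU covU /set0Pn[p /covU[x /(spanned0 symU) px]].
suff [v vK] : exists v, 0 < #|spanned sv U v K|.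
  by rewrite /weight (bigD1 v) //= ltn_addr.
have [-> | K_gt0] := posnP K; first by exists x; apply/card_gt0P; exists p.
have [|v _ Kv] := @eq_bigmax_cond _ (mem V) (level sv U).
  by apply/card_gt0P; exists x.
have {}Kv : level sv U v = K by rewrite -Kv; apply: eq_bigl.
exists v; apply: leq_trans (card_spanned_ge _ _ _ _).
by rewrite muln_gt0 expn_gt0 card_gt0 -Kv level_core ?Kv.
Qed.

Lemma potential_le L U : 0 < #|V| -> potential L U <= base ^ L.+1.
Proof.
move=> V_gt0; have n_gt0 : 0 < #|V| ^ 3 by rewrite expn_gt0 V_gt0.
have := geometric_sum_le L.+1 n_gt0 (leqnn _).
apply: leq_trans; rewrite big_distrr; apply: leq_sum => k _ /=.
rewrite mulnC leq_mul2r; apply/orP; right.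
exact: leq_trans (weight_le U k) (leq_pmull _ _).
Qed.

Lemma potential_set0 L : potential L set0 = 0.
Proof.
apply: big1 => k _; rewrite [weight _ _ _]big1 ?muln0 // => v _.
by apply/eqP; rewrite cards_eq0 -subset0 within_sub.
Qed.

(** As a natural number the potential is then at least 1, so its expectation bounds the probability
    that pairs remain uncovered. *)
Lemma potential_gt0 L U :
    symmetric_pairs U -> coverable U -> (forall v, level sv U v <= L) -> U != set0 ->
  0 < potential L U.
Proof.
move=> symU covU le_L U0; set K := \max_x level sv U x.
have KL : K < L.+1 by rewrite ltnS; apply/bigmax_leqP.
rewrite /potential (bigD1 (Ordinal KL)) //= ltn_addr // muln_gt0 weight_top //.
have /set0Pn[p _] := U0; rewrite expn_gt0 muln_gt0 expn_gt0.
by rewrite (_ : 0 < #|V|) //; apply/card_gt0P; exists p.1.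
Qed.

Section OnePhase.
Variables (bnd : V -> nat) (U : {set V * V}) (L : nat).
Local Notation draw := {dffun forall v : V, 'I_(bnd v).+1}.
Hypothesis irrU : irreflexive_pairs U.
Hypothesis symU : symmetric_pairs U.
Hypothesis covU : coverable U.
Hypothesis level_le : forall v, level sv U v <= L.
Hypothesis bnd_large : forall p v, p \in U -> p.1 \in N v -> 4 * #|N p.1| <= (bnd v).+1.

(** The top level keeps at most 126/128 of its term in expectation, and after the phase the lower
    levels together hold at most 1/128 of that term. *)
Lemma potential_drift :
  128 * (\sum_(r : draw) potential L (step sv N id U (ticket r)))
    <= 127 * #|{: draw}| * potential L U.
Proof.
have [U0|U0] := eqVneq U set0.
  rewrite big1 // => r _; suff -> : step sv N id U (ticket r) = set0 by exact: potential_set0.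
  by apply/eqP; rewrite -subset0; apply: subset_trans (step_sub _ _ _ _ _) _; rewrite U0.
pose K := \max_x level sv U x.
have le_K x : level sv U x <= K by apply: leq_bigmax.
have KL : K < L.+1 by rewrite ltnS; apply/bigmax_leqP.
have n_gt0 : 0 < #|V| ^ 3.
  by have /set0Pn[p _] := U0; rewrite expn_gt0; apply/orP; left; apply/card_gt0P; exists p.1.
have drift := @weight_drift V sv N id bnd sv_irr id_inj NC svN U K irrU le_K.
have {}drift : 64 * (\sum_(r : draw) weight sv (step sv N id U (ticket r)) K)
    <= 63 * #|{: draw}| * weight sv U K.
  apply: drift => v p pv.
  have pN : p.1 \in N v by rewrite NC; apply: spanned_nbr NC svN _ _ _ _ pv.
  apply: leq_trans (bnd_large (subsetP (within_sub _ _) _ pv) pN).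
  rewrite leq_mul2l /=; apply/subset_leq_card/subsetP => u; rewrite inE.
  exact: spanned_nbr NC svN _ _ _ _.
(* Lower levels get their worst-case weight; higher levels are empty before the phase and, by
   monotonicity, after it. *)
have pot_step r : potential L (step sv N id U (ticket r)) <=
    #|V| ^ 3 * (\sum_(k < K) base ^ k) + base ^ K * weight sv (step sv N id U (ticket r)) K.
  set U' := step _ _ _ _ _; rewrite /potential.
  rewrite -(big_mkord xpredT (fun k => base ^ k * weight sv U' k)).
  rewrite (big_cat_nat _ KL) //= big_nat_recr //= -addnA.
  rewrite [X in _ + (_ + X)](_ : _ = 0) ?addn0.
    rewrite leq_add2r big_mkord big_distrr; apply: leq_sum => k _ /=.
    by rewrite mulnC leq_mul2r weight_le orbT.
  rewrite big_nat_cond big1 // => k; rewrite andbT => /andP[lt_k _].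
  apply/eqP; rewrite muln_eq0 -[weight _ _ _ == 0]leqn0; apply/orP; right.
  apply: leq_trans (weightS _ (step_sub _ _ _ _ _)) _.
  by rewrite weight_eq0 // => v; apply: leq_ltn_trans (le_K v) lt_k.
have potU : base ^ K * weight sv U K <= potential L U.
  by rewrite /potential (bigD1 (Ordinal KL)) //= leq_addr.
have w_gt0 := weight_top symU covU U0.
have gsum := geometric_sum_le K n_gt0 (leqnn _).
have : \sum_(r : draw) potential L (step sv N id U (ticket r)) <=
    #|{: draw}| * (#|V| ^ 3 * (\sum_(k < K) base ^ k))
    + base ^ K * (\sum_(r : draw) weight sv (step sv N id U (ticket r)) K).
  rewrite -sum_nat_const [X in _ + X]big_distrr -big_split.
  by apply: leq_sum => r _; apply: pot_step.
move: w_gt0 gsum drift potU; rewrite -/K -/base -mulnA.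
move: (#|V| ^ 3 * _) (base ^ K) (weight sv U K) #|{: draw}| (\sum_r weight _ _ _).
move: (\sum_r potential _ _) (potential L U) => s q g b w n s'.
move=> w_gt0 gsum drift potU le_s.
apply: leq_trans (leq_mul (leqnn (127 * n)) potU).
have: 128 * (b * s') <= 126 * n * (b * w).
  rewrite [X in _ <= X](_ : _ = b * (126 * n * w)); last by rewrite mulnCA.
  by rewrite mulnCA leq_mul2l; apply/orP; right; lia.
have : n * (128 * g) <= n * (b * w).
  by rewrite leq_mul2l; apply/orP; right; apply: leq_trans gsum (leq_pmulr _ _).
lia.
Qed.

End OnePhase.
End Potential.

(** * Cost of one phase *)

Section TruncatedHarmonic.
Variable R : realType.
Local Open Scope ring_scope.
Implicit Types (a q : nat) (y : R).

(** Total charge of [q] pairs assigned to one star of the solution, when a pair covered with [j.+1]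
    of them left costs at most the term of index [j]. *)
Definition tharm a q : R := \sum_(j < q) Num.min 1 (a%:R / j.+1%:R).

Lemma tharmS a q : tharm a q.+1 = tharm a q + Num.min 1 (a%:R / q.+1%:R).
Proof. by rewrite /tharm big_ord_recr. Qed.

Lemma tharm0 q : tharm 0 q = 0.
Proof. by rewrite /tharm big1 // => j _; rewrite mul0r min_r // ler01. Qed.

(** Pairs covered in one phase all pay the price for [q] remaining pairs, which is the smallest of
    the terms that they use up. *)
Lemma tharm_step a q q' : (q' <= q)%N ->
  (q - q')%:R * Num.min 1 (a%:R / q%:R) <= tharm a q - tharm a q'.
Proof.
move=> le_q; rewrite -(subnK le_q); move: (q - q')%N => k; rewrite addnK addnC.
rewrite /tharm big_split_ord /= addrAC subrr add0r.
rewrite mulr_natl -[X in _ *+ X]card_ord -sumr_const; apply: ler_sum => j _.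
rewrite le_min !ge_min lexx /= ler_wpM2l ?orbT // lef_pV2 ?posrE ?ltr0n ?ler_nat ?addn_gt0.
- by rewrite ltn_add2l.
- by apply/orP; right; apply: leq_trans (ltn_ord j).
- by [].
Qed.

Lemma inv_le_ln n : (0 < n)%N -> n.+1%:R^-1 <= ln (n.+1%:R / n%:R : R).
Proof.
move=> n_gt0; have n0 : (n%:R : R) != 0 by rewrite pnatr_eq0 -lt0n.
have S0 : (n.+1%:R : R) != 0 by rewrite pnatr_eq0.
rewrite -[_ / _]invrK lnV ?posrE ?invr_gt0 ?divr_gt0 ?ltr0n //.
rewrite lerNr invf_div.
have -> : n%:R / n.+1%:R = 1 + - n.+1%:R^-1 :> R.
  by apply: (mulIf S0); rewrite divfK // mulrBl mulVf // mul1r -natr1 addrK.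
apply: le_ln1Dx; rewrite ltrN2 invf_lt1 ?ltr1n //.
Qed.

(** The parameter [y] is left free: it is taken as the maximum degree for one ratio and as
    [|C| / |V(C)|], raised to at least 1, for the other. *)
Lemma tharm_le a q y : 1 <= y -> tharm a q <= a%:R * (1 + ln y) + q%:R / y.
Proof.
move=> y1; have y0 : 0 < y by apply: lt_le_trans y1.
have [->|a_gt0] := posnP a; first by rewrite tharm0 mul0r add0r divr_ge0 // ltW.
have a0 : 0 < a%:R :> R by rewrite ltr0n.
have le_q p : tharm a p <= p%:R.
  rewrite -[X in X%:R]card_ord -[_%:R]sumr_const; apply: ler_sum => j _.
  by rewrite ge_min lexx.
have ln_y := ln_ge0 y1.
have [qa|aq] := leqP q a.
  apply: le_trans (le_q q) _; rewrite -[X in X <= _]addr0.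
  apply: lerD; last by rewrite divr_ge0 // ltW.
  by rewrite mulrDr mulr1 (le_trans (_ : q%:R <= a%:R)) ?ler_nat // lerDl mulr_ge0.
(* The first [a] terms are at most 1 each; the later ones are compared with increments of the
   logarithm. *)
have main : tharm a q <= a%:R + a%:R * ln (q%:R / a%:R).
  rewrite -(subnK (ltnW aq)); elim: (q - a)%N => [|k IHk].
    by rewrite add0n divff ?gt_eqF // ln1 mulr0 addr0.
  rewrite addSn tharmS; set m := (k + a)%N in IHk *.
  have m_gt0 : (0 < m)%N by rewrite addn_gt0 a_gt0 orbT.
  have m0 : 0 < m%:R :> R by rewrite ltr0n.
  have -> : m.+1%:R / a%:R = (m.+1%:R / m%:R) * (m%:R / a%:R) :> R.
    by rewrite mulrA divfK // gt_eqF.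
  rewrite lnM ?posrE ?divr_gt0 ?ltr0n // mulrDr addrCA addrC; apply: lerD => //.
  by rewrite ge_min ler_wpM2l ?inv_le_ln ?orbT.
apply: le_trans main _; rewrite mulrDr mulr1 -addrA lerD2l.
have q0 : 0 < q%:R :> R by rewrite ltr0n; apply: leq_trans aq.
(* Splits off [ln y]; the logarithm of the remaining factor is bounded by the factor itself, which
   yields [q / y]. *)
have -> : q%:R / a%:R = y * (q%:R / a%:R / y) by rewrite [RHS]mulrC divfK // gt_eqF.
rewrite lnM ?posrE ?divr_gt0 // mulrDr lerD2l.
have := ltW (ln_sublinear (_ : 0 < q%:R / a%:R / y)).
rewrite !divr_gt0 // => /(_ isT); rewrite -(ler_pM2l a0) => /le_trans; apply.
by rewrite mulrA mulrCA divff ?mulr1 // gt_eqF.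
Qed.

End TruncatedHarmonic.

(** * Charging the purchases of a phase to a feasible solution *)

Section PhaseCost.
Variables (R : realType) (V : finType) (sv N : V -> {set V}) (id : V -> nat).
Hypothesis sv_irr : forall v, v \notin sv v.
Hypothesis id_inj : injective id.
Hypothesis NC : forall u v, (u \in N v) = (v \in N u).
Hypothesis svN : forall v, v |: sv v \subset N v.

(* A feasible solution, as one star [T x] per vertex, and for each pair the
   center [c p] of a star that spans it. *)
Variables (T : V -> {set V}) (c : V * V -> V).
Hypothesis sT : forall x, T x \subset sv x.

Local Open Scope ring_scope.
Implicit Types (U : {set V * V}) (p : V * V) (t : V -> rat) (x : V).

Definition price U p : R := 8 / (2 ^ top sv N U p.1)%:R.

(** A bought star of level [l] has at least [2 ^ l] spanned pairs per leaf and an eighth as many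
    votes, so its voters pay for it. All of them become covered, and none pays twice. *)
Lemma cost_le_price U t :
  (\sum_x #|won sv N id U t x|)%:R <= \sum_(p in U :\: step sv N id U t) price U p.
Proof.
set S := _ :\: _.
apply: le_trans (_ : \sum_x \sum_(p in S | votes_for sv N id U t p x) price U p <= _); last first.
  rewrite (exchange_big_dep (mem S)) /=; last by move=> x p _ /andP[].
  apply: ler_sum => p pS; rewrite pS /=.
  have price_ge0 : 0 <= price U p by rewrite divr_ge0.
  case: (pickP (votes_for sv N id U t p)) => [x px|no].
    rewrite (bigD1 x) //= big1 ?addr0 // => y /andP[py ne].
    by case/eqP: ne; apply: votes_for_inj id_inj _ _ _ _ _ py px.
  by rewrite big_pred0.
rewrite natr_sum; apply: ler_sum => x _; rewrite /won.
have [wx|_] := boolP (wins _ _ _ _ _ _); last first.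
  by rewrite cards0 sumr_ge0 // => p _; rewrite divr_ge0.
pose l := level sv U x.
have -> : \sum_(p in S | votes_for sv N id U t p x) price U p =
    \sum_(p in votes sv N id U t x) 8 / (2 ^ l)%:R.
  apply: eq_big => [p|p /andP[_ /andP[/and3P[_ /eqP lx _] _]]]; last by rewrite /price -lx.
  rewrite !inE; case: (boolP (votes_for _ _ _ _ _ _ _)) => [vp|]; last by rewrite !andbF.
  by have := wins_notin_step vp wx; rewrite !inE => ->.
rewrite sumr_const -[X in _ <= X]mulr_natr mulrAC ler_pdivlMr ?ltr0n ?expn_gt0 //.
rewrite -!natrM ler_nat mulnC; apply: leq_trans (card_spanned_ge _ _ _ _) wx.
Qed.

Definition quota U x := #|[set p in U | c p == x]|.

(** The center [c p] has an empty core one step above its level, so [within_small] bounds the pairs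
    assigned to it. The 4 is the 2 for ordered pairs times the 2 of that step; [top] is at least the
    level because [c p] is near [p.1]. *)
Lemma price_le U p :
    irreflexive_pairs U -> symmetric_pairs U -> p \in U ->
    (forall p, p \in U -> p \in within U (c p |: T (c p))) ->
  price U p <= 8 * Num.min 1 ((4 * #|T (c p)|)%:R / (quota U (c p))%:R).
Proof.
move=> irrU symU Up covU; rewrite ler_pM2l //; set x := c p.
have qx : (0 < quota U x)%N by apply/card_gt0P; exists p; rewrite inE Up /=.
rewrite le_min invf_le1 ?ler1n ?ltr0n ?expn_gt0 //=.
rewrite ler_pdivlMr ?ltr0n // mulrC ler_pdivrMr ?ltr0n ?expn_gt0 // -natrM ler_nat.
have pN : x \in N p.1.
  rewrite NC; apply: (subsetP (svN x)).
  have := covU p Up; rewrite inE => /and3P[_ pX _].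
  by apply: (subsetP (setUS _ (sT x))) pX.
have le_top : (level sv U x <= top sv N U p.1)%N by apply: leq_bigmax_cond.
have core0 : core sv U x (level sv U x).+1 = set0.
  by apply/eqP; apply: contraT => /(core_le_level sv_irr irrU); rewrite ltnn.
have qW : (quota U x <= #|within U (x |: T x)|)%N.
  apply/subset_leq_card/subsetP => q; rewrite inE => /andP[Uq /eqP <-].
  exact: covU.
have := within_small sv_irr irrU symU core0 (sT x).
rewrite expnS mulnA => /(leq_trans qW)/leq_trans; apply.
by rewrite mulnAC leq_mul2l leq_exp2l // le_top orbT.
Qed.

(** Stated so that the phases telescope: the cost is paid by the decrease of the charges still to
    come. *)
Lemma phase_cost U t :
    irreflexive_pairs U -> symmetric_pairs U ->
    (forall p, p \in U -> p \in within U (c p |: T (c p))) ->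
  (\sum_x #|won sv N id U t x|)%:R
    + 8 * (\sum_x tharm R (4 * #|T x|) (quota (step sv N id U t) x))
  <= 8 * (\sum_x tharm R (4 * #|T x|) (quota U x)).
Proof.
move=> irrU symU covU; have := cost_le_price U t; have := step_sub sv N id U t.
move: (step _ _ _ _ _) => U' sU costU.
rewrite -lerBrDr -mulrBr -sumrB; apply: le_trans costU _.
apply: le_trans (_ : \sum_(p in U :\: U')
    8 * Num.min 1 ((4 * #|T (c p)|)%:R / (quota U (c p))%:R) <= _).
  by apply: ler_sum => p; rewrite inE => /andP[_ Up]; apply: price_le.
rewrite -mulr_sumr ler_pM2l //.
rewrite (partition_big c xpredT) //=; apply: ler_sum => x _.
have sq : [set p in U' | c p == x] \subset [set p in U | c p == x].
  by apply/subsetP => p /setIdP[/(subsetP sU) Up cp]; apply/setIdP.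
apply: le_trans _ (tharm_step R _ (subset_leq_card sq)).
rewrite (eq_bigr (fun=> Num.min 1 ((4 * #|T x|)%:R / (quota U x)%:R))); last first.
  by move=> p /andP[_ /eqP->].
rewrite -(cardsDS sq) sumr_const [X in _ <= X]mulr_natl /quota.
rewrite le_eqVlt; apply/orP; left; apply/eqP; congr (_ *+ _).
apply: eq_card => p; rewrite unfold_in /= !inE.
by case: (p \in U'); case: (p \in U); case: (c p == x).
Qed.

End PhaseCost.

(** * The distributed algorithm *)

(* In the four rounds of a phase a vertex sends: its uncovered client neighbours
   and its degree; the proposed star, its level and its ticket; for every pair it
   votes for on behalf of the receiver, the other end; the star it buys. *)
Definition content := (seq nat * nat * rat)%type.

(** Stages 0 to 3 are the rounds of a phase and stage 4 is the halted one. [mailA] and [mailB] keep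
    the messages of the first two rounds, [prize] the star bought in this phase. *)
Record vstate := VState {
  stage : nat;
  self : nat;
  servs : seq nat;
  degree : nat;
  uncovered : seq nat;
  chosen : seq nat;
  mailA : seq (nat * content);
  mailB : seq (nat * content);
  prize : seq nat
}.

Section LocalComputation.
Variable s : vstate.
Implicit Types (T X : seq nat) (i j k : nat).

Definition local_links X i := \sum_(e <- mailA s | e.1 == i) count (mem X) e.2.1.1.

Definition local_dense k T :=
  all (fun i => 2 ^ k <= local_links (self s :: T) i) T.

(** Brute force: all sublists of [servs s], encoded as masks, are tested for density. *)
Definition local_core k :=
  [seq i <- servs s | [exists m : (size (servs s)).-tuple bool,
     local_dense k (mask m (servs s)) && (i \in mask m (servs s))]].

Definition local_level := \max_(k < (size (servs s)).+1 | local_core k != [::]) k.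

Definition closed_star := self s :: local_core local_level.

Definition local_spanned :=
  \sum_(e <- mailA s | e.1 \in closed_star) count (mem closed_star) e.2.1.1.

(** As the number of vertices is unknown, the range is built from reported degrees: it exceeds four
    times the closed neighbourhood of each sender, or equals it for a single sender. The predecessor
    accounts for draws starting at 0. *)
Definition draw_range := (4 * \sum_(e <- mailA s) e.2.1.2.+1).-1.

Definition local_top := \max_(e <- mailB s) e.2.1.2.

Definition local_cands j :=
  [seq e <- mailB s | [&& e.2.1.2 == local_top, self s \in e.1 :: e.2.1.1
                        & j \in e.1 :: e.2.1.1]].

Definition ballot i :=
  [seq j <- uncovered s | has (fun e => (e.1 == i) &&
     all (fun e' => earlier (e.2.2, e.1) (e'.2.2, e'.1)) (local_cands j)) (local_cands j)].

Definition local_send (r i : nat) : content :=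
  match stage s with
  | 0 => (uncovered s, degree s, 0%R)
  | 1 => (local_core local_level, local_level, r.+1%:R / draw_range.+1%:R)%R
  | 2 => (ballot i, 0, 0%R)
  | _ => (prize s, 0, 0%R)
  end.

(** The vertex adds its own message to the inbox, since neighbourhoods are closed. It halts once
    nobody in [box] reports an uncovered pair. *)
Definition local_receive (r : nat) (inbox : seq (nat * content)) : vstate :=
  let: VState st me sr dg un ch mA mB pr := s in
  let box := (me, local_send r me) :: inbox in
  match st with
  | 0 => if all (fun e => nilp e.2.1.1) box then VState 4 me sr dg un ch mA mB pr
         else VState 1 me sr dg un ch box mB pr
  | 1 => VState 2 me sr dg un ch mA box pr
  | 2 => VState 3 me sr dg un ch mA mB
           (if local_spanned <= 8 * \sum_(e <- box) size e.2.1.1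
            then local_core local_level else [::])
  | _ => VState 0 me sr dg
           [seq j <- un | ~~ has (fun e => (me \in e.1 :: e.2.1.1)
                                          && (j \in e.1 :: e.2.1.1)) box]
           (ch ++ pr) mA mB pr
  end.

End LocalComputation.

Section ReceiveByStage.
Variables (s : vstate) (r : nat) (inbox : seq (nat * content)).
Let received := (self s, local_send s r (self s)) :: inbox.

Lemma local_receive0 : stage s = 0 ->
  local_receive s r inbox =
    if all (fun e => nilp e.2.1.1) received then
      VState 4 (self s) (servs s) (degree s) (uncovered s) (chosen s)
        (mailA s) (mailB s) (prize s)
    else VState 1 (self s) (servs s) (degree s) (uncovered s) (chosen s)
        received (mailB s) (prize s).
Proof. by rewrite /received; case: s => ? ? ? ? ? ? ? ? ? /= ->. Qed.

Lemma local_receive1 : stage s = 1 ->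
  local_receive s r inbox =
    VState 2 (self s) (servs s) (degree s) (uncovered s) (chosen s)
      (mailA s) received (prize s).
Proof. by rewrite /received; case: s => ? ? ? ? ? ? ? ? ? /= ->. Qed.

Lemma local_receive2 : stage s = 2 ->
  local_receive s r inbox =
    VState 3 (self s) (servs s) (degree s) (uncovered s) (chosen s) (mailA s) (mailB s)
      (if local_spanned s <= 8 * \sum_(e <- received) size e.2.1.1
       then local_core s (local_level s) else [::]).
Proof. by rewrite /received; case: s => ? ? ? ? ? ? ? ? ? /= ->. Qed.

Lemma local_receive3 : stage s = 3 ->
  local_receive s r inbox =
    VState 0 (self s) (servs s) (degree s)
      [seq j <- uncovered s | ~~ has (fun e => (self s \in e.1 :: e.2.1.1)
                                             && (j \in e.1 :: e.2.1.1)) received]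
      (chosen s ++ prize s) (mailA s) (mailB s) (prize s).
Proof. by rewrite /received; case: s => ? ? ? ? ? ? ? ? ? /= ->. Qed.

End ReceiveByStage.

Definition local_init (me : nat) (nbrs : seq (nat * (bool * bool))) : vstate :=
  VState 0 me [seq e.1 | e <- nbrs & e.2.2] (size nbrs)
    [seq e.1 | e <- nbrs & e.2.1] [::] [::] [::] [::].

Definition local_output (s : vstate) : option (seq nat) :=
  if stage s == 4 then Some (chosen s) else None.

Definition spanner_algorithm : local_algorithm :=
  LocalAlgorithm local_init draw_range local_send local_receive local_output.

(** * Lists of IDs as representations of vertex sets *)

Section Codes.
Variables (V : finType) (id : V -> nat).
Hypothesis id_inj : injective id.
Implicit Types (A : {set V}) (l : seq nat) (P : pred nat).

Definition codes l A := perm_eq l [seq id u | u <- enum A].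

Lemma codes_mem l A u : codes l A -> (id u \in l) = (u \in A).
Proof. by move/perm_mem->; rewrite mem_map // mem_enum. Qed.

Lemma codes_id l A i : codes l A -> i \in l -> exists2 u, u \in A & i = id u.
Proof. by move/perm_mem-> => /mapP[u]; rewrite mem_enum; exists u. Qed.

Lemma codes_size l A : codes l A -> size l = #|A|.
Proof. by move/perm_size->; rewrite size_map cardE. Qed.

Lemma codes_nilp l A : codes l A -> (l == [::]) = (A == set0).
Proof. by move/codes_size => e; rewrite -cards_eq0 -e size_eq0. Qed.

Lemma codes_count l A P : codes l A -> count P l = #|[set u in A | P (id u)]|.
Proof.
move/permP->; rewrite count_map -sum1_count big_enum_cond /= -sum1_card.
by apply: eq_bigl => u; rewrite inE.
Qed.

Lemma codes_filter l A P : codes l A -> codes (filter P l) [set u in A | P (id u)].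
Proof.
move=> cl; apply: perm_trans (perm_filter P cl) _; rewrite filter_map perm_map //.
apply: uniq_perm => [||u]; [exact/filter_uniq/enum_uniq | exact: enum_uniq |].
by rewrite mem_filter !mem_enum in_set; apply: andbC.
Qed.

Lemma codes_cons l A v : v \notin A -> codes l A -> codes (id v :: l) (v |: A).
Proof.
move=> vA cl; rewrite /codes -(perm_cons (id v)) in cl; apply: perm_trans cl _.
apply: uniq_perm.
- by rewrite /= (map_inj_uniq id_inj) enum_uniq mem_map // mem_enum vA.
- by rewrite (map_inj_uniq id_inj) enum_uniq.
move=> i; rewrite inE; apply/orP/mapP => [[/eqP->|/mapP[u]]|[u]].
- by exists v; rewrite // mem_enum setU11.
- by rewrite mem_enum => uA ->; exists u; rewrite // mem_enum in_setU1 uA orbT.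
- rewrite mem_enum => /setU1P[-> ->|uA ->]; [by left | right].
  by apply/mapP; exists u; rewrite ?mem_enum.
Qed.

Lemma codes_uniq l A : codes l A -> uniq l.
Proof. by move/perm_uniq->; rewrite (map_inj_uniq id_inj) enum_uniq. Qed.

End Codes.

(** * The view of a single vertex *)

Section LocalView.
Variables (V : finType) (sv N : V -> {set V}) (id : V -> nat).
Hypothesis sv_irr : forall v, v \notin sv v.
Hypothesis id_inj : injective id.
Hypothesis NC : forall u v, (u \in N v) = (v \in N u).
Hypothesis svN : forall v, v |: sv v \subset N v.
Implicit Types (U : {set V * V}) (u v w x : V) (s : vstate) (O : V -> seq nat).
Implicit Types (X T act : {set V}) (k : nat).

Definition partners U v := [set w | (v, w) \in U].

Lemma partnersS U U' v : U \subset U' -> partners U v \subset partners U' v.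
Proof. by move=> /subsetP sU; apply/subsetP => w; rewrite !inE; apply: sU. Qed.

Definition static U O v s :=
  [/\ self s = id v, codes id (servs s) (sv v), (degree s).+1 = #|N v|,
      codes id (uncovered s) (partners U v) & chosen s = O v].

Definition mail_from act v (msg : V -> content) (l : seq (nat * content)) :=
  perm_eq l [seq (id u, msg u) | u <- enum (N v :&: act)].

(** Only senders in [act] are heard; the others have no uncovered pair, so their missing reports
    would have been empty. *)
Definition knowsA U v s :=
  exists (act : {set V}) (unc : V -> seq nat),
  [/\ forall u, u \notin act -> partners U u = set0,
      forall u, u \in N v :&: act -> codes id (unc u) (partners U u)
    & mail_from act v (fun u => (unc u, #|N u|.-1, 0%R)) (mailA s)].

Lemma sum_mail act v msg l (P : pred nat) (F : content -> nat) :
  mail_from act v msg l ->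
  \sum_(e <- l | P e.1) F e.2 = \sum_(u in N v :&: act | P (id u)) F (msg u).
Proof. by move=> pl; rewrite (perm_big _ pl) big_map big_enum_cond. Qed.

Lemma sum_partners U X : \sum_(u in X) #|links U X u| = #|within U X|.
Proof.
under eq_bigr => u _ do rewrite -sum1_card.
rewrite pair_big_dep /= sum1dep_card; apply: eq_card => -[u w].
by rewrite !inE /=; case: (u \in X); case: (w \in X); case: (_ \in U).
Qed.

Lemma self_sv v T : T \subset sv v -> v \notin T.
Proof. by move=> sT; apply: contra (sv_irr v); apply: (subsetP sT). Qed.

Lemma sv_nbr v u T : T \subset sv v -> u \in v |: T -> u \in N v.
Proof. by move=> sT uT; apply: (subsetP (svN v)); apply: (subsetP (setUS _ sT)). Qed.

Section Round1.
Variables (U : {set V * V}) (O : V -> seq nat) (v : V) (s : vstate).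
Hypothesis stat : static U O v s.
Hypothesis know : knowsA U v s.

Lemma local_linksE X (l : seq nat) u : u \in N v -> codes id l X ->
  local_links s l (id u) = #|links U X u|.
Proof.
have [act [unc [inactive uncE mA]]] := know => uN cX.
rewrite /local_links (sum_mail (fun i => i == id u) (fun c => count (mem l) c.1.1) mA) /=.
have [ua|ua] := boolP (u \in act); last first.
  rewrite big_pred0 => [|w]; last first.
    apply/negP => /andP[+ /eqP/id_inj ewu]; rewrite ewu inE => /andP[_].
    exact/negP.
  apply/esym/eqP; rewrite cards_eq0 -subset0 -(inactive u ua).
  by apply/subsetP => w; rewrite !inE => /andP[].
have uNa : u \in N v :&: act by rewrite inE uN ua.
rewrite (big_pred1 u) => [|w]; last first.
  rewrite /= (inj_eq id_inj); apply/andP/eqP => [[_ /eqP]//|->]; by rewrite eqxx.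
rewrite (codes_count _ (uncE u uNa)); apply: eq_card => w.
by rewrite !inE /= (codes_mem id_inj _ cX) andbC.
Qed.

Lemma local_denseE k T (l : seq nat) : T \subset sv v -> codes id l T ->
  local_dense s k l = dense sv U v k T.
Proof.
have [selfE _ _ _ _] := stat => sT cT; rewrite /local_dense /dense sT selfE.
rewrite (perm_all _ cT) all_map; apply/allP/forall_inP => dT u uT.
  have := dT u; rewrite mem_enum => /(_ uT) /=.
  by rewrite (local_linksE _ (codes_cons id_inj (self_sv sT) cT)) ?(sv_nbr sT) // setU1r.
rewrite mem_enum in uT; rewrite /=.
by rewrite (local_linksE _ (codes_cons id_inj (self_sv sT) cT)) ?(sv_nbr sT) ?setU1r // dT.
Qed.

(** Sublists of [servs s] correspond to subsets of [sv v]. In one direction a dense mask is a dense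
    set, in the other the core is itself dense. *)
Lemma local_coreE k : codes id (local_core s k) (core sv U v k).
Proof.
have [_ csv _ _ _] := stat.
rewrite /local_core; set Q := (fun i => [exists m, _]).
have := codes_filter Q csv; rewrite (_ : [set u in sv v | Q (id u)] = core sv U v k) //.
apply/setP => u; rewrite inE; apply/andP/idP => [[usv /existsP[m /andP[dm um]]]|uc].
  pose T := [set w | id w \in mask m (servs s)].
  have cT : codes id (mask m (servs s)) T.
    apply: uniq_perm; rewrite ?mask_uniq ?(codes_uniq id_inj csv) //.
      by rewrite (map_inj_uniq id_inj) enum_uniq.
    move=> i; apply/idP/mapP => [im|[w]]; last by rewrite mem_enum inE => ? ->.
    have [w _ iw] := codes_id csv (mem_mask im).
    by exists w; rewrite // mem_enum inE -iw.
  have sT : T \subset sv v.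
    by apply/subsetP => w; rewrite inE => /mem_mask; rewrite (codes_mem id_inj _ csv).
  rewrite (local_denseE _ sT cT) in dm.
  by apply: (subsetP (dense_core dm)); rewrite inE.
have usv := subsetP (core_sub sv U v k) u uc.
split=> //; apply/existsP.
(* The witness is the mask that selects the core. *)
pose P i := i \in [seq id w | w <- enum (core sv U v k)].
exists [tuple of map P (in_tuple (servs s))].
rewrite /= -filter_mask mem_filter (codes_mem id_inj _ csv) usv andbT.
have cT : codes id (filter P (servs s)) (core sv U v k).
  apply: perm_trans (codes_filter P csv) _; rewrite (_ : [set _ in _ | _] = core sv U v k) //.
  apply/setP => w; rewrite inE /P mem_map // mem_enum andbC.
  by apply/andb_idr; apply: (subsetP (core_sub sv U v k)).
rewrite (local_denseE _ (core_sub _ _ _ _) cT) core_dense /=.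
by rewrite /P mem_map // mem_enum.
Qed.

Lemma local_levelE : local_level s = level sv U v.
Proof.
have [_ csv _ _ _] := stat; rewrite /local_level (codes_size csv) /level.
by apply: eq_bigl => k; rewrite (codes_nilp (local_coreE k)).
Qed.

Lemma local_starE : codes id (local_core s (local_level s)) (core sv U v (level sv U v)).
Proof. by rewrite local_levelE; apply: local_coreE. Qed.

Lemma local_spannedE : local_spanned s = #|spanned sv U v (level sv U v)|.
Proof.
have [selfE _ _ _ _] := stat; have [act [unc [inactive uncE mA]]] := know.
have cS : codes id (closed_star s) (v |: core sv U v (level sv U v)).
  by rewrite /closed_star selfE; apply: codes_cons local_starE => //; apply/self_sv/core_sub.
rewrite /local_spanned; move: (closed_star s) cS => l cS.
rewrite (sum_mail (fun i => i \in l) (fun c => count (mem l) c.1.1) mA) /= -sum_partners.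
rewrite [RHS](bigID (mem act)) /= [X in _ = _ + X]big1 ?addn0; last first.
  move=> u /andP[_ ua]; apply/eqP; rewrite cards_eq0 -subset0 -(inactive u ua).
  by apply/subsetP => w; rewrite !inE => /andP[].
apply: eq_big => [u|u /andP[ua _]].
  rewrite (codes_mem id_inj _ cS) inE andbAC [RHS]andbC andbC; congr (_ && _).
  apply/andb_idl; exact: sv_nbr (core_sub _ _ _ _).
rewrite (codes_count _ (uncE u ua)); apply: eq_card => w.
by rewrite !inE /= (codes_mem id_inj _ cS) !inE andbC.
Qed.

(** A vertex with an uncovered pair is active, so its degree was reported and is one summand of the
    range. *)
Lemma draw_range_ge u : u \in N v -> partners U u != set0 ->
  4 * #|N u| <= (draw_range s).+1.
Proof.
have [act [unc [inactive uncE mA]]] := know => uN pu.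
have ua : u \in act by apply: contraNT pu => /inactive ->.
have NvI u' : #|N u'|.-1.+1 = #|N u'|.
  rewrite prednK //; apply/card_gt0P; exists u'; apply: (subsetP (svN u')).
  exact: setU11.
rewrite /draw_range; have := sum_mail xpredT (fun c => c.1.2.+1) mA.
rewrite /= => ->; rewrite (bigD1 u) /= ?NvI; last by rewrite inE uN ua.
set b := \sum_(_ | _) _; have: 0 < #|N u| by rewrite -NvI.
by move: #|N u| b => a b; lia.
Qed.

End Round1.
End LocalView.

(** * Votes and purchases as seen by a single vertex *)

Section LocalVotes.
Variables (V : finType) (sv N : V -> {set V}) (id : V -> nat).
Hypothesis sv_irr : forall v, v \notin sv v.
Hypothesis id_inj : injective id.
Hypothesis NC : forall u v, (u \in N v) = (v \in N u).
Hypothesis svN : forall v, v |: sv v \subset N v.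
Implicit Types (U : {set V * V}) (u v w x : V) (s : vstate) (O : V -> seq nat).
Implicit Types (X T act : {set V}) (k : nat) (t : V -> rat).

(* Only inactive vertices halt, and they remain inactive. What they would still
   send has no influence, so their silence goes unnoticed. *)
Definition inactive U u := forall u', u' \in N u -> partners U u' = set0.

Lemma inactive_notin U u u' w : inactive U u -> u' \in N u -> (u', w) \notin U.
Proof. by move=> iu /iu/setP/(_ w); rewrite !inE => ->. Qed.

Lemma inactive_core U u k : inactive U u -> core sv U u k = set0.
Proof.
move=> iu; apply/eqP; rewrite -subset0; apply/subsetP => w wc.
have [x wx _] := core_mem wc; suff: (w, x) \notin U by rewrite wx.
apply: inactive_notin (iu) _.
exact: (sv_nbr svN (core_sub sv U u k) (setU1r _ wc)).
Qed.

Lemma inactive_level U u : inactive U u -> level sv U u = 0.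
Proof.
move=> iu; apply/eqP; rewrite -leqn0 leqNgt; apply/negP => /level_core.
by rewrite (inactive_core _ iu) eqxx.
Qed.

Lemma inactive_spanned U u k p : inactive U u -> p \notin spanned sv U u k.
Proof.
move=> iu; rewrite inE; apply/negP => /and3P[pU pu _]; move: pU; apply/negP.
rewrite [p]surjective_pairing; apply: inactive_notin (iu) _.
exact: (sv_nbr svN (core_sub sv U u k) pu).
Qed.

Lemma inactive_self U u : inactive U u -> partners U u = set0.
Proof. by apply; apply: (subsetP (svN u)); rewrite setU11. Qed.

Lemma inactive_won U t u : inactive U u -> won sv N id U t u = set0.
Proof. by move=> iu; rewrite /won inactive_core // if_same. Qed.

Definition knowsB U t v s :=
  exists (act : {set V}) (star : V -> seq nat),
  [/\ forall u, u \notin act -> inactive U u,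
      forall u, u \in N v :&: act -> codes id (star u) (core sv U u (level sv U u))
    & mail_from N id act v (fun u => (star u, level sv U u, t u)) (mailB s)].

Section Ballot.
Variables (U : {set V * V}) (t : V -> rat) (O : V -> seq nat) (v : V) (s : vstate).
Hypothesis stat : static sv N id U O v s.
Hypothesis know : knowsB U t v s.

Lemma local_topE : local_top s = top sv N U v.
Proof.
have [act [star [inact _ mB]]] := know.
rewrite /local_top (perm_big _ mB) big_map big_enum /= /top.
rewrite [RHS](bigID (mem act)) /= [X in maxn _ X]big1 ?maxn0.
  by apply: eq_bigl => u; rewrite inE.
by move=> u /andP[_ /inact]; apply: inactive_level.
Qed.

Lemma closed_core_mem u l w : codes id l (core sv U u (level sv U u)) ->
  (id w \in id u :: l) = (w \in u |: core sv U u (level sv U u)).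
Proof.
move=> cl; rewrite !inE (inj_eq id_inj).
by rewrite (codes_mem id_inj _ cl).
Qed.

(** Silent neighbours are inactive, so their stars span nothing and are not candidates: the received
    proposals determine the vote. *)
Lemma ballotE x :
  codes id (ballot s (id x)) [set w in partners U v | votes_for sv N id U t (v, w) x].
Proof.
have [selfE _ _ cU _] := stat; have [act [star [inact starE mB]]] := know.
apply: perm_trans (codes_filter _ cU) _.
rewrite (_ : [set _ in _ | _] = [set w in partners U v | votes_for sv N id U t (v, w) x]) //.
apply/setP => w; rewrite in_set [RHS]in_set; case vw: (w \in partners U v) => //=.
have {}vw : (v, w) \in U by rewrite inE in vw.
pose msg u : nat * content := (id u, (star u, level sv U u, t u)).
have candsP e : reflect (exists2 u, cand sv N U (v, w) u & e = msg u)
                        (e \in local_cands s (id w)).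
  rewrite mem_filter (perm_mem mB) local_topE selfE.
  have candE' u : u \in N v :&: act -> cand sv N U (v, w) u =
      [&& (msg u).2.1.2 == top sv N U v, id v \in (msg u).1 :: (msg u).2.1.1
        & id w \in (msg u).1 :: (msg u).2.1.1].
    move=> uN; rewrite !(closed_core_mem _ (starE u uN)) /cand /=.
    by move: uN; rewrite inE => /andP[-> _]; rewrite /= [_ \in spanned _ _ _ _]inE vw.
  apply: (iffP andP) => [[cu /mapP[u]]|[u cu eu]].
    by rewrite mem_enum => uN eu; exists u => //; rewrite candE' // -[msg u]eu.
  have uN : u \in N v :&: act.
    have /and3P[uN _ us] := cu; rewrite inE uN /=; apply: contraLR us => /inact.
    exact: inactive_spanned.
  split; last by rewrite eu map_f // mem_enum.
  by rewrite candE' // -eu in cu.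
apply/hasP/andP => [[e /candsP[u cu ->]] /= /andP[/eqP/id_inj eux /allP eu]|[cx /forall_inP ex]].
  rewrite -eux; split=> //; apply/forall_inP => y cy.
  by apply: (eu (msg y)); apply/candsP; exists y.
exists (msg x); first by apply/candsP; exists x.
rewrite eqxx; apply/allP => e /candsP[y cy ->]; exact: ex.
Qed.

End Ballot.

(** A pair that votes for [v] starts in [N v] at a vertex that is not inactive, so its ballot
    arrives. *)
Lemma sum_ballots U t v act (bal : V -> seq nat) (l : seq (nat * content)) :
    (forall u, u \notin act -> inactive U u) ->
    (forall u, u \in N v :&: act ->
       codes id (bal u) [set w in partners U u | votes_for sv N id U t (u, w) v]) ->
    mail_from N id act v (fun u => (bal u, 0, 0%R)) l ->
  \sum_(e <- l) size e.2.1.1 = #|votes sv N id U t v|.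
Proof.
move=> inact balE ml; rewrite (sum_mail xpredT (fun c => size c.1.1) ml) /=.
have -> : #|votes sv N id U t v| = \sum_u #|[set w in partners U u | votes_for sv N id U t (u, w) v]|.
  under eq_bigr => u _ do rewrite -sum1_card.
  rewrite pair_big_dep /= sum1dep_card; apply: eq_card => -[u w].
  by rewrite !inE.
rewrite [RHS](bigID (mem (N v :&: act))) /= [X in _ = _ + X]big1 ?addn0.
  by apply: eq_big => u; rewrite ?andbT // => uN; rewrite (codes_size (balE u uN)).
move=> u uN; apply/eqP; rewrite cards_eq0 -subset0; apply/subsetP => w.
rewrite !inE => /andP[uw /andP[/and3P[/= vu _ _] _]].
have uNv : u \in N v by rewrite NC.
move: uN; rewrite inE uNv /= => /inact/inactive_self/setP/(_ w).
by rewrite !inE uw.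
Qed.

Lemma closed_won_mem U t u (l : seq nat) w : codes id l (won sv N id U t u) ->
  (id w \in id u :: l) = (w \in u |: won sv N id U t u).
Proof. by move=> cl; rewrite !inE (inj_eq id_inj) (codes_mem id_inj _ cl). Qed.

Lemma won_sub U t u : won sv N id U t u \subset sv u.
Proof. by rewrite /won; case: ifP => _; [apply: core_sub | apply: sub0set]. Qed.

(** The center of a bought star that spans a pair of [v] is in the closed neighbourhood of [v], so
    [v] hears of it. An inactive center buys nothing and could span only a diagonal pair. *)
Lemma uncovered_step U t v act (pr : V -> seq nat) (unc : seq nat) (l : seq (nat * content)) :
    irreflexive_pairs U -> (forall u, u \notin act -> inactive U u) ->
    (forall u, u \in N v :&: act -> codes id (pr u) (won sv N id U t u)) ->
    mail_from N id act v (fun u => (pr u, 0, 0%R)) l ->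
    codes id unc (partners U v) ->
  codes id [seq j <- unc | ~~ has (fun e => (id v \in e.1 :: e.2.1.1)
                                          && (j \in e.1 :: e.2.1.1)) l]
    (partners (step sv N id U t) v).
Proof.
move=> irrU inact prE ml cU; apply: perm_trans (codes_filter _ cU) _.
rewrite (_ : [set _ in _ | _] = partners (step sv N id U t) v) //.
apply/setP => w; rewrite in_set inE [RHS]inE inE andbC; case vw: (_ \in U); rewrite ?andbF //= !andbT.
congr (~~ _); rewrite (perm_has _ ml) has_map.
apply/hasP/bigcupP => [[u]|[u _]].
  rewrite mem_enum => uN /=; rewrite !(closed_won_mem _ (prE u uN)) => uvw.
  by exists u => //; rewrite inE vw.
rewrite inE vw /= => /andP[vu wu].
have uN : u \in N v by rewrite NC (sv_nbr svN (won_sub U t u) vu).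
have ua : u \in act.
  apply: contraT => /inact iu; move: vu wu; rewrite inactive_won // !inE !orbF.
  by move=> /eqP ev /eqP ew; have := irrU u; rewrite -{1}ev -ew vw.
have uNa : u \in N v :&: act by rewrite inE uN.
exists u; first by rewrite mem_enum.
by rewrite /= !(closed_won_mem _ (prE u uNa)) vu.
Qed.

End LocalVotes.

(** * Four rounds implement one phase *)

Section Rounds.
Variables (V : finType) (G : cs_instance V) (id : V -> nat).
Hypothesis id_inj : injective id.

Definition srv v := [set u | adj (servers G) v u].
Definition nbd v := v |: [set u | adj (edges G) v u].
Definition client_pairs := [set p | adj (clients G) p.1 p.2].

Implicit Types (U : {set V * V}) (u v w : V) (O : V -> seq nat).
Implicit Types (act : {set V}) (t : V -> rat).
Implicit Types (x : configuration spanner_algorithm V).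

Lemma adjC (F : {set {set V}}) u v : adj F u v = adj F v u.
Proof. by rewrite /adj setUC. Qed.

Lemma adj_irr u : ~~ adj (edges G) u u.
Proof.
rewrite /adj setUid; apply/negP => /(edges_simple (c := G)).
by rewrite cards1.
Qed.

Lemma srv_irr v : v \notin srv v.
Proof. by rewrite inE; apply: contra (adj_irr v); apply: (subsetP (servers_sub G)). Qed.

Lemma nbdC u v : (u \in nbd v) = (v \in nbd u).
Proof. by rewrite !inE eq_sym adjC. Qed.

Lemma srv_nbd v : v |: srv v \subset nbd v.
Proof.
by apply/setUS/subsetP => u; rewrite !inE; apply: (subsetP (servers_sub G)).
Qed.

Lemma neighboursE v : perm_eq (neighbours G id v) (enum [set u | adj (edges G) v u]).
Proof. by rewrite /neighbours perm_sort. Qed.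

Local Notation static := (static srv nbd id).
Local Notation knowsA := (knowsA nbd id).
Local Notation knowsB := (knowsB srv nbd id).
Local Notation inactive := (inactive nbd).
Local Notation prizes := (won srv nbd id).
Local Notation step := (step srv nbd id).

Definition running x := [set v | stage (x v) != 4].

Lemma haltedE x v : halted x v = (v \notin running x).
Proof. by rewrite /halted /= /local_output inE; case: eqP. Qed.

Definition box x (r : V -> nat) v : seq (nat * content) :=
  (id v, local_send (x v) (r v) (id v)) ::
  [seq (id u, local_send (x u) (r u) (id v)) | u <- neighbours G id v & ~~ halted x u].

Lemma mail_from_box x r v (msg : V -> content) :
    v \in running x ->
    (forall u, u \in nbd v :&: running x -> local_send (x u) (r u) (id v) = msg u) ->
  mail_from nbd id (running x) v msg (box x r v).
Proof.
move=> vr msgE; rewrite /mail_from.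
have nv : perm_eq (v :: [seq u <- neighbours G id v | ~~ halted x u])
                  (enum (nbd v :&: running x)).
  have nbrE := neighboursE v.
  apply: uniq_perm => [||u]; last 1 first.
  - rewrite in_cons mem_filter (perm_mem nbrE) !mem_enum haltedE negbK.
    rewrite in_setI in_setU1 in_set; case: eqP => [->|_] /=; first by rewrite vr.
    exact: andbC.
  - rewrite /= mem_filter (perm_mem nbrE) mem_enum inE (negbTE (adj_irr v)) andbF /=.
    by rewrite filter_uniq // (perm_uniq nbrE) enum_uniq.
  - exact: enum_uniq.
have -> : box x r v = [seq (id u, local_send (x u) (r u) (id v))
                      | u <- v :: [seq u <- neighbours G id v | ~~ halted x u]] by [].
apply: perm_trans (perm_map _ nv) _.
rewrite (_ : map _ _ = [seq (id u, msg u) | u <- enum (nbd v :&: running x)]) //.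
by apply/eq_in_map => u; rewrite mem_enum => /msgE ->.
Qed.

Lemma roundE x (r : draws x) v : self (x v) = id v ->
  round G id r v = if v \in running x then
     local_receive (x v) (r v) (behead (box x (fun u => r u) v)) else x v.
Proof. by move=> _; rewrite /round ffunE haltedE /=; case: (v \in running x). Qed.

Definition rep0 U O x := forall v, static U O v (x v) /\
  (stage (x v) = 4 /\ inactive U v \/ stage (x v) = 0).

(** Recording that [U] is non-empty for unhalted vertices is what forces everyone to halt once all
    pairs are covered. *)
Definition rep1 U O x := forall v, static U O v (x v) /\
  (stage (x v) = 4 /\ inactive U v \/
   [/\ stage (x v) = 1, U != set0 & knowsA U v (x v)]).

Definition rep2 U t O x := forall v, static U O v (x v) /\
  (stage (x v) = 4 /\ inactive U v \/
   [/\ stage (x v) = 2, knowsA U v (x v) & knowsB U t v (x v)]).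

Definition rep3 U t O x := forall v, static U O v (x v) /\
  (stage (x v) = 4 /\ inactive U v \/
   stage (x v) = 3 /\ codes id (prize (x v)) (prizes U t v)).

Lemma round0 U O x (r : draws x) : rep0 U O x -> rep1 U O (round G id r).
Proof.
move=> rx v; have [stat st] := rx v; have [selfE sE dE uE cE] := stat.
have inact u : u \notin running x -> inactive U u.
  by rewrite inE negbK => /eqP e4; have [_ [[]|]] := rx u; rewrite ?e4.
rewrite roundE //; case: ifPn => [vr|vr]; last first.
  split=> //; left; split; last exact: inact.
  by apply/eqP; move: vr; rewrite inE negbK.
have {}st : stage (x v) = 0 by case: st => [[e4 _]|//]; rewrite inE e4 in vr.
have mA : mail_from nbd id (running x) v
    (fun u => (uncovered (x u), #|nbd u|.-1, 0%R)) (box x (fun u => r u) v).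
  apply: mail_from_box => // u; rewrite !inE => /andP[_ ur].
  have [[_ _ du _ _] [[e4 _]|e0]] := rx u; first by rewrite e4 in ur.
  by rewrite /local_send e0 -du.
have unc u : u \in nbd v :&: running x -> codes id (uncovered (x u)) (partners U u).
  by move=> _; have [[]] := rx u.
have boxE : (self (x v), local_send (x v) (r v) (self (x v))) ::
   behead (box x (fun u => r u) v) = box x (fun u => r u) v by rewrite selfE.
rewrite (local_receive0 _ _ st) boxE.
case: ifPn => [/allP nil|nall]; split=> //=; last first.
  right; split=> //.
    apply: contraNneq nall => U0; apply/allP => e; rewrite (perm_mem mA).
    case/mapP => u; rewrite mem_enum => /unc cu ->; apply/nilP/eqP.
    by rewrite (codes_nilp cu) -subset0; apply/subsetP => w; rewrite U0 !inE.
  by exists (running x), (fun u => uncovered (x u)); split=> // u /inact/(inactive_self srv_nbd).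
left; split=> // u uv; have [ur|/inact/(inactive_self srv_nbd)//] := boolP (u \in running x).
have uN : u \in nbd v :&: running x by rewrite inE uv.
apply/eqP; rewrite -(codes_nilp (unc u uN)); apply/eqP/nilP; apply: (nil (id u, (uncovered (x u), #|nbd u|.-1, 0%R))).
by rewrite (perm_mem mA); apply/mapP; exists u; rewrite ?mem_enum.
Qed.

Lemma round1 U O x (r : draws x) :
  rep1 U O x -> rep2 U (ticket (bnd := fun v => draw_bound (x v)) r) O (round G id r).
Proof.
move=> rx v; set t := ticket _.
have [stat st] := rx v; have [selfE sE dE uE cE] := stat.
have inact u : u \notin running x -> inactive U u.
  by rewrite inE negbK => /eqP e4; have [_ [[]|[]]] := rx u; rewrite ?e4.
rewrite roundE //; case: ifPn => [vr|vr]; last first.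
  split=> //; left; split; last exact: inact.
  by apply/eqP; move: vr; rewrite inE negbK.
have {st} [st _ kA] : [/\ stage (x v) = 1, U != set0 & knowsA U v (x v)].
  by case: st => [[e4 _]|//]; rewrite inE e4 in vr.
have r1 u : u \in running x -> stage (x u) = 1 /\ knowsA U u (x u).
  by rewrite inE => ur; have [_ [[e4 _]|[]//]] := rx u; rewrite e4 in ur.
pose star u := local_core (x u) (local_level (x u)).
have mB : mail_from nbd id (running x) v
    (fun u => (star u, level srv U u, t u)) (box x (fun u => r u) v).
  apply: mail_from_box => // u; rewrite in_setI => /andP[_ /r1[e1 kAu]].
  have [statu _] := rx u.
  by rewrite /local_send e1 /star {2}(local_levelE srv_irr id_inj srv_nbd statu kAu).
have starE u : u \in nbd v :&: running x -> codes id (star u) (core srv U u (level srv U u)).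
  rewrite in_setI => /andP[_ /r1[_ kAu]]; have [statu _] := rx u.
  exact: (local_starE srv_irr id_inj srv_nbd statu kAu).
have boxE : (self (x v), local_send (x v) (r v) (self (x v))) ::
   behead (box x (fun u => r u) v) = box x (fun u => r u) v by rewrite selfE.
rewrite (local_receive1 _ _ st) boxE.
split=> //; right; split=> //; exists (running x), star; by split.
Qed.

Lemma round2 U t O x (r : draws x) : rep2 U t O x -> rep3 U t O (round G id r).
Proof.
move=> rx v; have [stat st] := rx v; have [selfE sE dE uE cE] := stat.
have inact u : u \notin running x -> inactive U u.
  by rewrite inE negbK => /eqP e4; have [_ [[]|[]]] := rx u; rewrite ?e4.
rewrite roundE //; case: ifPn => [vr|vr]; last first.
  split=> //; left; split; last exact: inact.
  by apply/eqP; move: vr; rewrite inE negbK.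
have {st} [st kA kB] : [/\ stage (x v) = 2, knowsA U v (x v) & knowsB U t v (x v)].
  by case: st => [[e4 _]|//]; rewrite inE e4 in vr.
pose bal u := ballot (x u) (id v).
have r2 u : u \in running x -> stage (x u) = 2 /\ knowsB U t u (x u).
  by rewrite inE => ur; have [_ [[e4 _]|[]//]] := rx u; rewrite e4 in ur.
have mC : mail_from nbd id (running x) v
    (fun u => (bal u, 0, 0%R)) (box x (fun u => r u) v).
  apply: mail_from_box => // u; rewrite in_setI => /andP[_ /r2[e2 _]].
  by rewrite /local_send e2.
have balE u : u \in nbd v :&: running x ->
    codes id (bal u) [set w in partners U u | votes_for srv nbd id U t (u, w) v].
  rewrite in_setI => /andP[_ /r2[_ kBu]]; have [statu _] := rx u.
  exact: (ballotE id_inj srv_nbd statu kBu v).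
have votesE := sum_ballots nbdC srv_nbd inact balE mC.
have spanE := local_spannedE srv_irr id_inj srv_nbd stat kA.
have starE := local_starE srv_irr id_inj srv_nbd stat kA.
have boxE : (self (x v), local_send (x v) (r v) (self (x v))) ::
   behead (box x (fun u => r u) v) = box x (fun u => r u) v by rewrite selfE.
rewrite (local_receive2 _ _ st) boxE.
split=> //; right; split=> //=.
rewrite spanE votesE /won /wins; case: ifP => // _.
by rewrite /codes enum_set0.
Qed.

Lemma round3 U t O x (r : draws x) : irreflexive_pairs U -> rep3 U t O x ->
  exists2 O' : V -> seq nat, rep0 (step U t) O' (round G id r)
    & forall v, exists2 l, codes id l (prizes U t v) & O' v = O v ++ l.
Proof.
move=> irrU rx.
have inact u : u \notin running x -> inactive U u.
  by rewrite inE negbK => /eqP e4; have [_ [[]|[]]] := rx u; rewrite ?e4.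
have r3 u : u \in running x -> stage (x u) = 3 /\ codes id (prize (x u)) (prizes U t u).
  by rewrite inE => ur; have [_ [[e4 _]|//]] := rx u; rewrite e4 in ur.
exists (fun v => chosen (round G id r v)) => v; last first.
  have [[selfE _ _ _ cE] _] := rx v; rewrite roundE //; case: ifPn => [vr|vr].
    have [e3 prE] := r3 v vr; exists (prize (x v)) => //.
    by rewrite -cE (local_receive3 _ _ e3).
  exists [::]; last by rewrite cats0.
  by rewrite (inactive_won id srv_nbd t (inact v vr)) /codes enum_set0.
have [[selfE sE dE uE cE] _] := rx v.
have sS : step U t \subset U := step_sub _ _ _ _ _.
have inactS u : inactive U u -> inactive (step U t) u.
  by move=> iu w /iu pw; apply/eqP; rewrite -subset0 -pw partnersS.
rewrite roundE //; case: ifPn => [vr|vr]; last first.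
  have iv := inact v vr; split; last first.
    by left; split; [apply/eqP; move: vr; rewrite inE negbK | apply: inactS].
  split=> //; last by rewrite roundE // (negbTE vr).
  by rewrite (inactive_self srv_nbd (inactS v iv)) -(inactive_self srv_nbd iv).
have [st prE] := r3 v vr.
have mD : mail_from nbd id (running x) v
    (fun u => (prize (x u), 0, 0%R)) (box x (fun u => r u) v).
  apply: mail_from_box => // u; rewrite in_setI => /andP[_ /r3[e3 _]].
  by rewrite /local_send e3.
have prizeE u : u \in nbd v :&: running x -> codes id (prize (x u)) (prizes U t u).
  by rewrite in_setI => /andP[_ /r3[]].
have uncE := uncovered_step id_inj nbdC srv_nbd irrU inact prizeE mD uE.
have boxE : (self (x v), local_send (x v) (r v) (self (x v))) ::
   behead (box x (fun u => r u) v) = box x (fun u => r u) v by rewrite selfE.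
rewrite (local_receive3 _ _ st) boxE.
split; last by right.
split=> //=; first by rewrite selfE.
by rewrite roundE // vr (local_receive3 _ _ st).
Qed.

Lemma rep0_init : rep0 client_pairs (fun=> [::]) (init_configuration spanner_algorithm G id).
Proof.
move=> v; rewrite /init_configuration ffunE; split; last by right.
have nbrE := neighboursE v.
have sel (F : {set {set V}}) : F \subset edges G ->
    codes id [seq id u | u <- neighbours G id v & adj F v u] [set u | adj F v u].
  move=> sF; rewrite /codes; apply: perm_map.
  apply: uniq_perm => [||u]; [|exact: enum_uniq|].
    by rewrite filter_uniq // (perm_uniq nbrE) enum_uniq.
  rewrite mem_filter (perm_mem nbrE) !mem_enum !inE.
  by apply/andb_idr; apply: (subsetP sF).
split=> //=.
- rewrite filter_map -map_comp; exact/sel/servers_sub.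
- rewrite size_map (perm_size nbrE) -cardE cardsU1 inE.
  by rewrite (negbTE (adj_irr v)).
rewrite filter_map -map_comp (_ : partners _ v = [set u | adj (clients G) v u]).
  exact/sel/clients_sub.
by apply/setP => u; rewrite !inE.
Qed.

End Rounds.

(** * Comparison with a feasible solution *)

Section Solutions.
Variables (V : finType) (G : cs_instance V) (id : V -> nat).
Hypothesis id_inj : injective id.
Implicit Types (U : {set V * V}) (u v w x y : V) (O : V -> seq nat) (F H : {set {set V}}).

Local Notation srv := (srv G).
Local Notation nbd := (nbd G).
Local Notation P0 := (client_pairs G).

Definition leaves H x := [set u | adj H x u].

Lemma simple_sub F : F \subset edges G -> simple_graph F.
Proof. by move=> sF e eF; apply: (edges_simple (c := G)); apply: (subsetP sF). Qed.

Lemma card_adj_pairs F : simple_graph F -> #|[set p : V * V | adj F p.1 p.2]| <= 2 * #|F|.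
Proof.
move=> simF; rewrite -sum1_card.
rewrite (partition_big (fun p : V * V => [set p.1; p.2]) (mem F)) /=; last first.
  by move=> p; rewrite inE.
rewrite mulnC -sum_nat_const; apply: leq_sum => e eF.
have /eqP/cards2P[a [b [_ eE]]] := simF e eF.
rewrite sum1_card.
apply: leq_trans (_ : #|[set (a, b); (b, a)]| <= 2); last by rewrite cards2; case: eqP.
apply/subset_leq_card/subsetP => -[u w]; rewrite unfold_in /= => /andP[_ /eqP uwe].
have uw : u != w.
  by apply/eqP => euw; have := simF e eF; rewrite -uwe euw setUid cards1.
have : u \in e by rewrite -uwe set21.
have : w \in e by rewrite -uwe set22.
rewrite eE !inE => /orP[]/eqP ew /orP[]/eqP eu; rewrite ew eu ?eqxx ?orbT //.
  by rewrite ew eu eqxx in uw.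
by rewrite ew eu eqxx in uw.
Qed.

Lemma sum_leaves F : simple_graph F -> \sum_x #|leaves F x| <= 2 * #|F|.
Proof.
move=> simF; apply: leq_trans (card_adj_pairs simF).
under eq_bigr => x _ do rewrite -sum1_card.
rewrite pair_big_dep /= sum1dep_card; apply/eq_leq/eq_card => -[u w].
by rewrite !inE.
Qed.

Lemma card_leaves F x : #|leaves F x| <= max_degree F.
Proof.
apply: leq_trans (leq_bigmax x).
have inj : injective (fun u => [set x; u]).
  move=> u w /setP e; have := e u; rewrite !inE eqxx orbT => /esym/orP[]/eqP // ux.
  by have := e w; rewrite !inE eqxx orbT ux orbb => /eqP.
rewrite -(card_imset _ inj); apply/subset_leq_card/subsetP => e /imsetP[u].
by rewrite inE => xu ->; rewrite inE set21 andbT.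
Qed.

Lemma clients_irr : irreflexive_pairs P0.
Proof.
move=> u; rewrite inE /=; apply: contra (adj_irr G u).
exact: (subsetP (clients_sub G)).
Qed.

Lemma clients_sym : symmetric_pairs P0.
Proof. by move=> u w; rewrite !inE adjC. Qed.

(** On a path with one edge the center is an end, with two edges it is the middle vertex; the empty
    path would need a loop. *)
Lemma solution_center H p :
    is_solution (clients G) (servers G) H -> p \in P0 ->
  exists x, p \in within P0 (x |: leaves H x).
Proof.
case: p => u w [_ spanH] uw; have uw0 := uw; rewrite inE in uw.
have [[|a [|b [|b' p]]] [/= pP lP sP]] := spanH u w uw.
- by move: uw0; rewrite lP; move/negP: (clients_irr w).
- exists u; rewrite inE uw0 /= setU11 in_setU1 inE -lP.
  by move: pP; rewrite andbT => ->; rewrite orbT.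
- exists a; move: pP => /and3P[ua ab _].
  by rewrite inE uw0 /= !in_setU1 !inE adjC ua -lP ab !orbT.
by [].
Qed.

Lemma leaves_srv H x : is_solution (clients G) (servers G) H -> leaves H x \subset srv x.
Proof.
by case=> sH _; apply/subsetP => u; rewrite !inE; apply: (subsetP sH).
Qed.

Lemma coverable_sub U : U \subset P0 -> coverable srv U.
Proof.
move=> sU p Up; have [H solH] := instance_feasible G.
have [x] := solution_center solH (subsetP sU p Up).
rewrite inE => /and3P[_ px qx]; exists x; rewrite inE Up.
have sX := setUS [set x] (leaves_srv x solH).
by rewrite (subsetP sX _ px) (subsetP sX _ qx).
Qed.

(** The default [p.1] is never reached on client pairs when [H] is a solution. *)
Definition center H p := odflt p.1 [pick x | p \in within P0 (x |: leaves H x)].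

Lemma center_within H U p : U \subset P0 ->
    is_solution (clients G) (servers G) H -> p \in U ->
  p \in within U (center H p |: leaves H (center H p)).
Proof.
move=> sU solH Up; rewrite /center; case: pickP => [x|no].
  by rewrite !inE Up => /andP[_ ->].
by have [x] := solution_center solH (subsetP sU p Up); rewrite no.
Qed.

(** Each vertex of a client edge must be incident to [H]. This lower bound on the optimum gives the
    ratio in terms of [|C| / |V(C)|]. *)
Lemma card_cover_clients H :
  is_solution (clients G) (servers G) H -> #|cover (clients G)| <= 2 * #|H|.
Proof.
move=> solH; have [sH spanH] := solH.
have simH : simple_graph H := simple_sub (subset_trans sH (servers_sub G)).
apply: leq_trans (_ : #|cover H| <= _); last first.
  apply: leq_trans (leq_card_cover H) _; rewrite mulnC -sum_nat_const.
  by apply: leq_sum => e /simH ->.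
apply/subset_leq_card/subsetP => u /bigcupP[e eC ue].
have /eqP/cards2P[a [b [ne eE]]] := simple_sub (clients_sub G) eC.
have [w ew] : exists w, e = [set u; w].
  by move: ue; rewrite eE !inE => /orP[]/eqP->; [exists b | exists a; rewrite setUC].
have uw : [set u; w] \in clients G by rewrite -ew.
have [[|a' p] [/= pP lP _]] := spanH u w uw.
  by have := clients_irr u; rewrite inE /adj /= {2}lP uw.
by move: pP => /andP[ua _]; apply/bigcupP; exists [set u; a']; rewrite // set21.
Qed.

(** * The two bounds on the total charge *)

Section ApproximationRatio.
Variable R : realType.
Local Open Scope ring_scope.
Local Notation size_bound H U :=
  (8 * \sum_x tharm R (4 * #|leaves H x|) (quota (center H) U x)).

Lemma size_bound_le H (y : R) :
    is_solution (clients G) (servers G) H -> 1 <= y ->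
  size_bound H P0 <= 64 * #|H|%:R * (1 + ln y) + 8 * #|P0|%:R / y.
Proof.
move=> solH y1; have [sH _] := solH.
have simH : simple_graph H := simple_sub (subset_trans sH (servers_sub G)).
have ln_y := ln_ge0 y1.
apply: le_trans (_ : 8 * \sum_x ((4 * #|leaves H x|)%:R * (1 + ln y)
    + (quota (center H) P0 x)%:R / y) <= _).
  by rewrite ler_pM2l //; apply: ler_sum => x _; apply: tharm_le.
rewrite big_split /= -!mulr_suml -!natr_sum mulrDr -big_distrr /=.
rewrite [X in _ + _ * (X%:R / _)](_ : _ = #|P0|); last first.
  rewrite -[RHS]sum1_card (partition_big (center H) xpredT) //=.
  by apply: eq_bigr => x _; rewrite /quota -sum1dep_card.
rewrite !mulrA lerD2r ler_wpM2r ?addr_ge0 // -!natrM ler_nat.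
have := sum_leaves simH; move: (\sum_x _)%N #|H| => a b; lia.
Qed.

(** With [y = D] the second term of [tharm_le] is at most twice the number of leaves, since a star
    with [a] leaves spans at most [a * a.+1] pairs. This gives 6 = 4 + 2 and 96 = 8 * 6 * 2. *)
Lemma size_bound_degree H :
    is_solution (clients G) (servers G) H ->
  size_bound H P0 <= 96 * #|H|%:R * (1 + ln (max_degree (servers G))%:R).
Proof.
move=> solH; have [sH _] := solH; set D := max_degree _.
have simH : simple_graph H := simple_sub (subset_trans sH (servers_sub G)).
have leD x : (#|leaves H x| <= D)%N.
  apply: leq_trans (card_leaves (servers G) x); apply: subset_leq_card.
  exact: leaves_srv.
have [D0|D_gt0] := posnP D.
  rewrite big1 => [|x _]; last first.
    by have := leD x; rewrite D0 leqn0 => /eqP->; rewrite muln0 tharm0.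
  by rewrite mulr0 !mulr_ge0 // D0 ln0 // addr0.
have D1 : 1 <= D%:R :> R by rewrite ler1n.
have ln_D := ln_ge0 D1.
apply: le_trans (_ : 8 * \sum_x ((6 * #|leaves H x|)%:R * (1 + ln D%:R)) <= _).
  rewrite ler_pM2l //; apply: ler_sum => x _.
  apply: le_trans (tharm_le _ _ D1) _.
  rewrite (_ : 6 = 4 + 2)%N // mulnDl natrD mulrDl lerD2l.
  apply: le_trans (_ : (2 * #|leaves H x|)%:R <= _); last first.
    by rewrite -[X in X <= _]mulr1 ler_wpM2l // lerDl.
  rewrite ler_pdivrMr ?ltr0n // -natrM ler_nat.
  apply: leq_trans (_ : #|within P0 (x |: leaves H x)| <= _)%N.
    apply/subset_leq_card/subsetP => p; rewrite inE => /andP[pP /eqP <-].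
    exact: center_within.
  apply: leq_trans (card_star _ _ clients_irr) _.
  by have := leD x; move: #|leaves H x| => a; move: (D) => b; nia.
rewrite -mulr_suml -natr_sum -big_distrr mulrA ler_wpM2r ?addr_ge0 //= -!natrM ler_nat.
have := sum_leaves simH; move: (\sum_x _)%N #|H| => a b; lia.
Qed.

Lemma size_bound_approx H :
    is_solution (clients G) (servers G) H ->
  size_bound H P0 <= 192 * approx_bound R G * #|H|%:R.
Proof.
move=> solH; have [sH _] := solH.
have h0 : 0 <= #|H|%:R :> R by [].
rewrite /approx_bound; set L1 := ln (_ / _); set L2 := ln _.
have le2 : size_bound H P0 <= 96 * #|H|%:R * (1 + L2) := size_bound_degree solH.
(* With this [y], [#|P0| / y] is at most [2 * |V(C)|], hence at most [4 * #|H|]. An empty cover,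
   where the quotient is 0, is treated apart. *)
set y := Num.max 1 (#|clients G|%:R / #|cover (clients G)|%:R : R).
have y1 : 1 <= y by rewrite le_max lexx.
have y0 : 0 < y by apply: lt_le_trans y1.
have le1 : size_bound H P0 <= 96 * #|H|%:R * (1 + ln y).
  apply: le_trans (size_bound_le solH y1) _.
  have : #|P0|%:R / y <= 2 * (2 * #|H|%:R) :> R.
    apply: le_trans (_ : 2 * #|cover (clients G)|%:R <= _).
      rewrite ler_pdivrMr //.
      apply: le_trans (_ : (2 * #|clients G|)%:R <= _).
        by rewrite ler_nat card_adj_pairs //; apply/simple_sub/clients_sub.
      rewrite natrM -mulrA ler_pM2l //.
      have [c0|c_gt0] := posnP #|cover (clients G)|.
        rewrite (_ : clients G = set0) ?cards0 ?mulr_ge0 // ?ltW //.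
        apply/eqP; rewrite -subset0; apply/subsetP => e eC.
        have := simple_sub (clients_sub G) eC.
        have : e \subset cover (clients G) by apply: bigcup_sup.
        by move/subset_leq_card; rewrite c0; case: #|e|.
      apply: le_trans (_ : #|cover (clients G)|%:R *
        (#|clients G|%:R / #|cover (clients G)|%:R) <= _).
        by rewrite mulrCA divff ?mulr1 // pnatr_eq0 -lt0n.
      by rewrite ler_wpM2l // le_max lexx orbT.
    by rewrite ler_pM2l // -natrM ler_nat card_cover_clients.
  have : 0 <= #|H|%:R * ln y by rewrite mulr_ge0 ?ln_ge0.
  rewrite -[8 * _ / y]mulrA -2!mulrA mulrDr mulr1.
  move: (#|H|%:R * ln y) (#|H|%:R : R) (#|P0|%:R / y) => m h z; lra.
have lny : ln y <= Num.max 1 L1.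
  rewrite /y; case: (leP 1 (#|clients G|%:R / _)) => [a1|_]; last by rewrite ln1 le_max ler01.
  by rewrite le_max lexx orbT.
have {le1} le1 : size_bound H P0 <= 192 * Num.max 1 L1 * #|H|%:R.
  apply: le_trans le1 _; have m1 : 1 <= Num.max 1 L1 by rewrite le_max lexx.
  move: lny m1; move: (ln y) (Num.max 1 L1) => l m lm m1.
  have : #|H|%:R * (1 + l) <= #|H|%:R * (2 * m) by rewrite ler_wpM2l //; lra.
  by nra.
have {le2} le2 : size_bound H P0 <= 192 * Num.max 1 L2 * #|H|%:R.
  apply: le_trans le2 _; have m1 : 1 <= Num.max 1 L2 by rewrite le_max lexx.
  have lm : L2 <= Num.max 1 L2 by rewrite le_max lexx orbT.
  move: lm m1; move: L2 (Num.max 1 L2) => l m lm m1.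
  have : #|H|%:R * (1 + l) <= #|H|%:R * (2 * m) by rewrite ler_wpM2l //; lra.
  by nra.
by case: (leP L1 L2).
Qed.

End ApproximationRatio.
End Solutions.

(** * Correctness of executions *)

Section Executions.
Variables (V : finType) (G : cs_instance V) (id : V -> nat).
Hypothesis id_inj : injective id.
Implicit Types (U : {set V * V}) (u v w y : V) (O : V -> seq nat) (H : {set {set V}}).
Implicit Types (x : configuration spanner_algorithm V).

Local Notation srv := (srv G).
Local Notation nbd := (nbd G).
Local Notation P0 := (client_pairs G).
Local Notation step := (step srv nbd id).
Local Notation solution := (is_solution (clients G) (servers G)).
Local Notation rep0 := (rep0 G id).

Lemma irr_sub U : U \subset P0 -> irreflexive_pairs U.
Proof. by move=> sU; apply: irreflexive_sub sU (clients_irr G). Qed.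

Lemma halt_set0 O x (r : draws x) v : rep0 set0 O x ->
  output (round G id r v) = Some (O v).
Proof.
move=> /(round0 r)/(_ v) [[_ _ _ _ cE] [[e4 _]|[_ /eqP//]]].
by rewrite /= /local_output e4 cE.
Qed.

Lemma phase U O x (r0 : draws x) (r1 : draws (round G id r0))
    (r2 : draws (round G id r1)) (r3 : draws (round G id r2)) :
    irreflexive_pairs U -> rep0 U O x ->
  exists2 O' : V -> seq nat,
      rep0 (step U (ticket (bnd := fun v => draw_bound (round G id r0 v)) r1)) O'
        (round G id r3)
    & forall v, exists2 l, codes id l (won srv nbd id U
        (ticket (bnd := fun v => draw_bound (round G id r0 v)) r1) v) & O' v = O v ++ l.
Proof.
move=> irrU /(round0 r0)/(round1 id_inj r1)/(round2 id_inj r2).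
exact: round3.
Qed.

Definition picked O v := [set w | id w \in O v].

(** The last clause is amortised: what has been bought plus the charges still to come never exceeds
    the initial charges, against every solution at once. *)
Definition invariant (R : realType) U O : Prop :=
  [/\ U \subset P0, symmetric_pairs U,
      forall v i, i \in O v -> exists2 u, u \in srv v & i = id u,
      forall p, p \in P0 -> p \notin U -> exists y, p \in within P0 (y |: picked O y)
    & forall H, solution H ->
      ((\sum_v size (O v))%:R
        + 8 * (\sum_y tharm R (4 * #|leaves H y|) (quota (center G H) U y))
       <= 8 * (\sum_y tharm R (4 * #|leaves H y|) (quota (center G H) P0 y)))%R].

Lemma invariant_init R : invariant R P0 (fun=> [::]).
Proof.
split=> //; first exact: clients_sym; first by move=> p ->.
by move=> H _; rewrite big1 // add0r.
Qed.

Lemma invariant_step R U O O' t :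
    invariant R U O ->
    (forall v, exists2 l, codes id l (won srv nbd id U t v) & O' v = O v ++ l) ->
  invariant R (step U t) O'.
Proof.
case=> sU symU inO covO costO stepO; have sS := step_sub srv nbd id U t.
have sizeO v : size (O' v) = size (O v) + #|won srv nbd id U t v|.
  by have [l cl ->] := stepO v; rewrite size_cat (codes_size cl).
have memO v w : (id w \in O' v) = (id w \in O v) || (w \in won srv nbd id U t v).
  by have [l cl ->] := stepO v; rewrite mem_cat (codes_mem id_inj _ cl).
split.
- exact: subset_trans sS sU.
- exact: symmetric_step.
- move=> v i; have [l cl ->] := stepO v; rewrite mem_cat => /orP[/inO//|/(codes_id cl)].
  case=> u uw ->; exists u => //; exact: (subsetP (won_sub srv nbd id U t v)).
- move=> p p0 pS; have [Up|/(covO p p0)[y]] := boolP (p \in U); last first.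
    rewrite in_set p0 /= !in_setU1 ![_ \in picked _ _]in_set => /andP[p1 p2].
    exists y; rewrite in_set p0 /= !in_setU1 ![_ \in picked _ _]in_set !memO.
    by case/orP: p1 => ->; case/orP: p2 => ->; rewrite ?orbT.
  have [y _ py] : exists2 y, true & p \in within U (y |: won srv nbd id U t y).
    by apply/bigcupP; move: pS; rewrite in_setD Up andbT negbK.
  exists y; move: py; rewrite in_set Up /= => /andP[p1 p2]; rewrite in_set p0 /=.
  have sW : y |: won srv nbd id U t y \subset y |: picked O' y.
    by apply/setUS/subsetP => w ww; rewrite inE memO ww orbT.
  by rewrite (subsetP sW _ p1) (subsetP sW _ p2).
move=> H solH; apply: le_trans (costO H solH).
under eq_bigr => v _ do rewrite sizeO.
rewrite big_split natrD -addrA lerD2l.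
apply: (phase_cost R (@srv_irr V G) id_inj (@nbdC V G) (@srv_nbd V G))
  => //; first by move=> y; apply: leaves_srv.
  exact: irr_sub.
by move=> p pU; apply: center_within.
Qed.

(** By [step_proper] each phase covers at least one pair, whatever the draws. *)
Lemma execution_phase R (x : nat -> configuration spanner_algorithm V) k :
    execution G id x ->
  exists U O, [/\ rep0 U O (x (4 * k)), invariant R U O & (U = set0 \/ #|U| + k <= #|P0|)].
Proof.
case=> x0 xS; elim: k => [|k [U [O [rk invk decr]]]].
  exists P0, (fun=> [::]); split; last by right; rewrite addn0.
    by rewrite x0; apply: rep0_init.
  exact: invariant_init.
have [r0 e1] := xS (4 * k); have [r1 e2] := xS (4 * k).+1.
have [r2 e3] := xS (4 * k).+2; have [r3 e4] := xS (4 * k).+3.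
have -> : 4 * k.+1 = (4 * k).+4 by lia.
rewrite e4; move: r3 {e4}; rewrite e3; move: r2 {e3}; rewrite e2; move: r1 {e2}.
rewrite e1 => r1 r2 r3.
have [sU symU _ _ _] := invk; have irrU := irr_sub sU.
have [O' rS stepO] := phase r3 irrU rk.
exists (step U (ticket r1)), O'; split=> //; first exact: invariant_step invk stepO.
have [U0|U0] := eqVneq U set0.
  by left; apply/eqP; rewrite -subset0 -U0 step_sub.
right; case: decr => [/eqP|decr]; first by rewrite (negbTE U0).
have := step_proper id (@srv_irr V G) (@nbdC V G) (@srv_nbd V G)
  (ticket r1) irrU symU U0 (coverable_sub sU).
by move/proper_card; lia.
Qed.

Section Output.
Variables (R : realType) (O : V -> seq nat) (x : configuration spanner_algorithm V).
Hypothesis inv : invariant R set0 O.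
Hypothesis outE : forall v, output (x v) = Some (O v).

Lemma mem_output y w : id w \in O y -> [set y; w] \in output_edges id x.
Proof.
move=> yw; apply/bigcupP; exists y => //; apply/imsetP; exists w => //.
by rewrite inE outE.
Qed.

Lemma output_solution : solution (output_edges id x).
Proof.
have [_ _ inO covO _] := inv; split.
  apply/subsetP => e /bigcupP[v _ /imsetP[u]]; rewrite inE outE /= => uO ->.
  by have [w] := inO v _ uO; rewrite inE => vw /id_inj ->.
move=> u w uw; have uwP : (u, w) \in P0 by rewrite inE.
have [|y] := covO (u, w) uwP; first by rewrite inE.
rewrite inE uwP /= => /andP[]; rewrite !in_setU1 ![_ \in picked _ _]inE.
have irr := clients_irr G.
move=> /orP[/eqP uy|yu] /orP[/eqP wy|yw].
- by have := irr u; rewrite {2}uy -wy uwP.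
- by exists [:: w]; split=> //=; rewrite andbT /adj uy mem_output.
- by exists [:: w]; split=> //=; rewrite andbT adjC /adj wy mem_output.
by exists [:: y; w]; split=> //=; rewrite andbT adjC /adj !mem_output.
Qed.

Lemma output_card : #|output_edges id x| <= \sum_v size (O v).
Proof.
apply: leq_trans (_ : \sum_v #|[set [set v; u] | u in [pred u | id u \in O v]]| <= _).
  rewrite /output_edges; under eq_bigr => v _ do rewrite outE /=.
  elim/big_rec2: _ => [|v n S _ IH]; first by rewrite cards0.
  by apply: leq_trans (leq_card_setU _ _) _; rewrite leq_add2l.
apply: leq_sum => v _; apply: leq_trans (leq_imset_card _ _) _.
rewrite cardE -(size_map id); apply: uniq_leq_size.
  by rewrite (map_inj_uniq id_inj) enum_uniq.
by move=> i /mapP[u]; rewrite mem_enum inE => uO ->.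
Qed.

Lemma output_ratio H : solution H ->
  (#|output_edges id x|%:R <= 192 * approx_bound R G * #|H|%:R)%R.
Proof.
move=> solH; apply: le_trans (size_bound_approx R solH).
have [_ _ _ _ /(_ H solH)] := inv; apply: le_trans.
apply: le_trans (_ : (\sum_v size (O v))%:R <= _)%R; first by rewrite ler_nat output_card.
rewrite lerDl mulr_ge0 // sumr_ge0 // => y _; rewrite /tharm sumr_ge0 // => j _.
by rewrite le_min ler01 divr_ge0.
Qed.

End Output.

Lemma execution_correct R (x : nat -> configuration spanner_algorithm V) :
    execution G id x ->
  exists T, [/\ all_halted (x T), solution (output_edges id (x T))
    & forall H, is_minimum_solution (clients G) (servers G) H ->
        (#|output_edges id (x T)|%:R <= 192 * approx_bound R G * #|H|%:R)%R].
Proof.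
move=> ex; have [U [O [rk inv decr]]] := execution_phase R #|P0| ex.
have U0 : U = set0.
  case: decr => // le; apply/eqP; rewrite -cards_eq0; move: le.
  by rewrite -[X in _ <= X]add0n leq_add2r leqn0.
subst U; have [_ xS] := ex; have [r xr] := xS (4 * #|P0|).
have outE v : output (x (4 * #|P0|).+1 v) = Some (O v) by rewrite xr; apply: halt_set0.
(* The extra round lets the vertices learn that no pair is left. *)
exists (4 * #|P0|).+1; split.
- by apply/forallP => v; rewrite /halted outE.
- exact: (output_solution inv outE).
- by move=> H [solH _]; apply: (output_ratio inv outE solH).
Qed.

End Executions.

(** * Halting probability *)

Section HaltingProbability.
Variables (R : realType) (V : finType) (G : cs_instance V) (id : V -> nat).
Hypothesis id_inj : injective id.
Implicit Types (U : {set V * V}) (u v w y : V) (O : V -> seq nat).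
Implicit Types (x : configuration spanner_algorithm V).
Local Open Scope ring_scope.

Local Notation srv := (srv G).
Local Notation nbd := (nbd G).
Local Notation P0 := (client_pairs G).
Local Notation step := (step srv nbd id).
Local Notation rep0 := (rep0 G id).
Local Notation prob := (prob_halted_from (A := spanner_algorithm) G id R).
Local Notation tickets x r := (ticket (bnd := fun v => draw_bound (x v)) r).

Lemma card_draws_gt0 x : (0 < #|{: draws x}|)%N.
Proof. by rewrite card_draws prodn_gt0. Qed.

Lemma prob_avg m x (f : draws x -> R) :
    (forall r, f r <= prob m (round G id r)) ->
  (\sum_r f r) / #|{: draws x}|%:R <= prob m.+1 x.
Proof.
move=> le_f; rewrite /= ler_wpM2r ?invr_ge0 //.
by apply: ler_sum => r _.
Qed.

Lemma prob_const m x (a : R) :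
  (forall r : draws x, a <= prob m (round G id r)) -> a <= prob m.+1 x.
Proof.
move=> /prob_avg; rewrite sumr_const -[X in X / _]mulr_natr mulfK //.
by rewrite pnatr_eq0 -lt0n card_draws_gt0.
Qed.

Lemma prob_ge0 m x : 0 <= prob m x.
Proof.
elim: m x => [|m IH] x; first by rewrite /= ler0n.
by apply: prob_const.
Qed.

Lemma prob_set0 O x : rep0 set0 O x -> prob 1 x = 1.
Proof.
move=> r0; have all1 (r : draws x) : all_halted (round G id r).
  by apply/forallP => v; rewrite /halted (halt_set0 _ _ r0).
apply/eqP; rewrite eq_le; apply/andP; split.
  rewrite /= ler_pdivrMr ?ltr0n ?card_draws_gt0 // mul1r -[X in _ <= X%:R]sum1_card natr_sum.
  by apply: ler_sum => r _; rewrite all1.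
by apply: prob_const => r; rewrite /= all1.
Qed.

(** Only the draws of the second round of a phase, the tickets, affect the uncovered set, so only
    they are averaged; the other three rounds keep a uniform lower bound. *)
Lemma prob_phase U O x m (f : {set V * V} -> R) (a : R) :
    irreflexive_pairs U -> rep0 U O x ->
    (forall t O' x', rep0 (step U t) O' x' -> f (step U t) <= prob m x') ->
    (forall r0 : draws x,
      a * #|{: draws (round G id r0)}|%:R <=
        \sum_(r1 : draws (round G id r0)) f (step U (tickets (round G id r0) r1))) ->
  a <= prob m.+4 x.
Proof.
move=> irrU rU le_f le_a; apply: prob_const => r0.
apply: le_trans (prob_avg (f := fun r1 => f (step U (tickets (round G id r0) r1))) _).
  by rewrite ler_pdivlMr ?ltr0n ?card_draws_gt0.
move=> r1; apply: prob_const => r2; apply: prob_const => r3.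
by have [O' rS _] := phase id_inj r3 irrU rU; apply: le_f rS.
Qed.

Lemma tickets_large U O x (p : V * V) v :
    rep1 G id U O x -> p \in U -> p.1 \in nbd v ->
  (4 * #|nbd p.1| <= (draw_bound (x v)).+1)%N.
Proof.
move=> rx pU pv.
have pp : partners U p.1 != set0.
  by apply/set0Pn; exists p.2; rewrite inE -surjective_pairing.
have [stat [[_ inact]|[_ _ kA]]] := rx v; first by rewrite (inact _ pv) eqxx in pp.
exact: (draw_range_ge (@srv_nbd V G) kA pv pp).
Qed.

(** Markov's inequality by induction on the phases. At the start either nothing is uncovered and one
    round suffices, or the potential is at least 1 and the bound is at most 0. *)
Lemma prob_halted_ge L U O x m :
    (forall (W : {set V * V}) v, W \subset P0 -> (level srv W v <= L)%N) ->
    U \subset P0 -> symmetric_pairs U -> rep0 U O x ->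
  1 - (127 / 128) ^+ m * (potential srv L U)%:R <= prob (4 * m).+1 x.
Proof.
move=> leL; elim: m U O x => [|m IH] U O x sU symU rU.
  rewrite expr0 mul1r; have [U0|U0] := eqVneq U set0.
    by rewrite U0 in rU; rewrite (prob_set0 rU) lerBlDr lerDl.
  apply: le_trans (prob_ge0 _ _); rewrite subr_le0 ler1n.
  by apply: potential_gt0 symU (coverable_sub sU) _ U0 => v; apply: leL.
have irrU := irr_sub sU.
rewrite (_ : (4 * m.+1).+1 = (4 * m).+1.+4)%N; last by lia.
pose f W := 1 - (127 / 128) ^+ m * (potential srv L W)%:R : R.
apply: (prob_phase (f := f) irrU rU) => // [t O' x' rS | r0].
  apply: IH rS; last exact: symmetric_step.
  exact: subset_trans (step_sub _ _ _ _ _) sU.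
have rx1 := round0 r0 rU.
have := potential_drift (@srv_irr V G) id_inj (@nbdC V G) (@srv_nbd V G) irrU symU
  (coverable_sub sU) (fun v => leL U v sU) (fun p v => tickets_large rx1).
rewrite -(ler_nat R) !natrM natr_sum /f sumrB sumr_const -mulr_sumr.
have q0 : 0 <= (127 / 128) ^+ m :> R by rewrite exprn_ge0 // divr_ge0.
rewrite exprSr; move: q0; move: ((127 / 128) ^+ m : R) (\sum_i _) => q s q0.
pose n : R := #|{: draws (round G id r0)}|%:R; pose pot : R := (potential srv L U)%:R.
change (128 * s <= 127 * n * pot -> (1 - q * (127 / 128) * pot) * n <= n - q * s).
move=> drift; have : q * (128 * s) <= q * (127 * n * pot) by rewrite ler_wpM2l.
by move: drift => _; nra.
Qed.

Lemma level_bound (W : {set V * V}) v : W \subset P0 ->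
  (level srv W v <= trunc_log 2 (max_degree (servers G)))%N.
Proof.
move=> sW; have [->//|l_gt0] := posnP (level srv W v).
apply: trunc_log_max => //; apply: leq_trans (card_leaves (servers G) v).
exact: (level_card (@srv_irr V G) (irr_sub sW) l_gt0).
Qed.

(** For such degrees the logarithm vanishes and only a constant number of rounds is allowed: one
    phase of four rounds and the halting round. *)
Lemma prob_matching : (max_degree (servers G) <= 1)%N ->
  1 <= prob 5 (init_configuration spanner_algorithm G id).
Proof.
move=> D1; have irr := @clients_irr V G.
have srv1 v : (#|srv v| <= 1)%N := leq_trans (card_leaves (servers G) v) D1.
have S0 t : step P0 t = set0.
  exact: (step_matching id (@srv_irr V G) (@nbdC V G) (@srv_nbd V G) t irr
            (@clients_sym V G) (coverable_sub (subxx _)) srv1).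
apply: (prob_phase (f := fun=> 1) irr (rep0_init G id)) => // [t O' x'|r0].
  by rewrite S0 => /prob_set0->.
by rewrite sumr_const mul1r.
Qed.

End HaltingProbability.

(** * Numerical estimates for the number of rounds *)

Section Numerics.
Variable R : realType.
Local Open Scope ring_scope.

Lemma ln2_ge : 1 / 2 <= ln 2 :> R.
Proof.
have : ln (1 + - (1 / 2)) <= - (1 / 2) :> R by apply: le_ln1Dx; lra.
rewrite (_ : 1 + - (1 / 2) = 2^-1 :> R); last by lra.
by rewrite lnV ?posrE // lerN2.
Qed.

Lemma decay_le (w n q m : nat) (c : R) : (0 < w)%N -> (0 < n)%N ->
    128 * (q%:R * ln w%:R + c * ln n%:R) <= m%:R ->
  (127 / 128) ^+ m * (w ^ q)%:R <= 1 / (n%:R `^ c) :> R.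
Proof.
move=> w_gt0 n_gt0 le_m; have w0 : 0 < w%:R :> R by rewrite ltr0n.
have n0 : 0 < n%:R :> R by rewrite ltr0n.
have d0 : 0 < 127 / 128 :> R by rewrite divr_gt0.
rewrite div1r natrX -ler_ln ?posrE ?mulr_gt0 ?invr_gt0 ?exprn_gt0 ?powR_gt0 //.
rewrite lnM ?posrE ?exprn_gt0 // lnV ?posrE ?powR_gt0 // ln_powR !lnXn //.
have : ln (127 / 128) <= - (1 / 128) :> R.
  rewrite (_ : 127 / 128 = 1 + - (1 / 128)); last by lra.
  by apply: le_ln1Dx; lra.
move=> lnd; have : ln (127 / 128) *+ m <= - (1 / 128) *+ m :> R by rewrite lerMn2r lnd orbT.
rewrite -[X in _ <= X]mulr_natr -[ln w%:R *+ q]mulr_natl.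
by move: (_ *+ m) => z; lra.
Qed.

End Numerics.

Local Open Scope ring_scope.

Lemma max_degree_gt0 (V : finType) (F : {set {set V}}) :
  (0 < max_degree F)%N -> F != set0.
Proof.
apply: contraTneq => ->; rewrite -leqNgt; apply/bigmax_leqP => v _.
by rewrite leqn0 cards_eq0 -subset0; apply/subsetP => e; rewrite !inE.
Qed.

Lemma card_vertices_ge2 (V : finType) (G : cs_instance V) :
  (0 < max_degree (servers G))%N -> (2 <= #|V|)%N.
Proof.
move=> /max_degree_gt0/set0Pn[e eS].
by rewrite -(simple_sub (servers_sub G) eS) max_card.
Qed.

Lemma log_base_le (R : realType) (n : nat) : (2 <= n)%N ->
  ln (256 * n ^ 3)%:R <= 11 * ln n%:R :> R.
Proof.
move=> n2; have n0 : 0 < n%:R :> R by rewrite ltr0n; apply: leq_trans n2.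
rewrite natrM natrX (_ : 256%N = 2 ^ 8)%N // natrX.
rewrite lnM ?posrE ?exprn_gt0 // !lnXn //.
rewrite -[_ *+ 8]mulr_natl -[_ *+ 3]mulr_natl.
have : ln 2%:R <= ln n%:R :> R by rewrite ler_ln ?posrE ?ler_nat.
by move: (ln _) (ln _) => a b; lra.
Qed.

(** As [ln 2] is at least 1/2, both [trunc_log 2 d] and 1 are at most [2 * ln d]. *)
Lemma log_level_le (R : realType) (d : nat) : (2 <= d)%N ->
  (trunc_log 2 d).+1%:R <= 4 * ln d%:R :> R.
Proof.
move=> d2; have d_gt0 : (0 < d)%N by apply: ltnW.
have : ln (2 ^ trunc_log 2 d)%N%:R <= ln d%:R :> R.
  by rewrite ler_ln ?posrE ?ler_nat ?ltr0n ?expn_gt0 // trunc_logP.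
rewrite natrX lnXn // -[ln _ *+ _]mulr_natl.
have : ln 2%:R <= ln d%:R :> R by rewrite ler_ln ?posrE ?ler_nat ?ltr0n.
rewrite -[(trunc_log _ _).+1%:R]natr1; have := ln2_ge R; have : 0 <= (trunc_log 2 d)%:R :> R by [].
move: (ln 2) (ln d%:R) (trunc_log _ _)%:R => a b l l0 a2 ab lab.
have : 0 <= l * (a - 1 / 2) by rewrite mulr_ge0 // subr_ge0.
by lra.
Qed.

Theorem theorem34 (R : realType) :
  exists (A : local_algorithm) (K : R), forall c : R, 1 <= c ->
  exists K' : R,
  forall (V : finType) (G : cs_instance V) (id : V -> nat), injective id ->
    (forall x : nat -> configuration A V, execution G id x ->
       exists T : nat,
         [/\ all_halted (x T),
             is_solution (clients G) (servers G) (output_edges id (x T))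
           & forall Hopt : {set {set V}},
               is_minimum_solution (clients G) (servers G) Hopt ->
               #|output_edges id (x T)|%:R <=
                 K * approx_bound R G * #|Hopt|%:R])
    /\
    (exists T : nat,
       T%:R <= K' * round_bound R G /\
       1 - 1 / (#|V|%:R `^ c) <= prob_halted A G id R T).
Proof.
(* With [m <= X + 1], [4 * m + 1] rounds are at most [512 * (L.+1 * lw + c * ln_n) + 5]. Here 44 = 4
   * 11 comes from [log_level_le] and [log_base_le], and [2 * c] from [1 <= 2 * ln D]. *)
exists spanner_algorithm, 192 => c c1; exists (512 * (44 + 2 * c) + 5).
move=> V G id id_inj; split=> [x|]; first exact: (execution_correct id_inj R).
set D := max_degree (servers G).
have b1 : 1 <= round_bound R G by rewrite le_max lexx.
have [D1|D2] := leqP D 1.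
  exists 5; split; first by move: b1; move: (round_bound R G) => b b1; nra.
  apply: le_trans (prob_matching R id_inj D1).
  by rewrite lerBlDr lerDl divr_ge0 ?powR_ge0.
have V2 : (2 <= #|V|)%N by apply/(@card_vertices_ge2 _ G)/ltnW.
have V0 : (0 < #|V|)%N by apply: ltnW.
set L := trunc_log 2 D; set lw : R := ln (base V)%:R; set ln_n : R := ln #|V|%:R.
(* This many phases bring the initial potential, at most [base V ^ L.+1], below the allowed failure
   probability, by [decay_le]. *)
pose X : R := 128 * (L.+1%:R * lw + c * ln_n).
have lwE : lw <= 11 * ln_n := log_base_le R V2.
have LE : L.+1%:R <= 4 * ln D%:R :> R := log_level_le R D2.
have n0 : 0 <= ln_n by rewrite ln_ge0 // ler1n.
have lw0 : 0 <= lw.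
  by rewrite ln_ge0 // ler1n /base muln_gt0 expn_gt0 V0.
have X0 : 0 <= X.
  by rewrite mulr_ge0 // addr_ge0 // mulr_ge0 // (le_trans _ c1).
pose m := (Num.trunc X).+1.
have mX : X <= m%:R by apply/ltW; case/andP: (truncn_itv X0).
have Xm : m%:R <= X + 1 by rewrite /m -natr1 lerD2r; case/andP: (truncn_itv X0).
exists (4 * m).+1; split.
  have bB : ln_n * ln D%:R <= round_bound R G by rewrite le_max lexx orbT.
  have LlE : L.+1%:R * lw <= 44 * (ln_n * ln D%:R).
    apply: le_trans (ler_pM _ lw0 LE lwE) _ => //.
    by rewrite mulrACA (mulrC (ln D%:R)) -natrM.
  have cE : c * ln_n <= 2 * c * (ln_n * ln D%:R).
    have : 1 <= 2 * ln D%:R :> R.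
      have : ln 2%:R <= ln D%:R :> R.
        by rewrite ler_ln ?posrE ?ler_nat ?ltr0n // ltnW.
      have := ln2_ge R; lra.
    have : 0 <= c * ln_n by rewrite mulr_ge0 // (le_trans _ c1).
    by move: (ln D%:R) => d; nra.
  rewrite -natr1 natrM; move: Xm; rewrite /X.
  have : 0 <= (round_bound R G - ln_n * ln D%:R) * (44 + 2 * c).
    by rewrite mulr_ge0 ?subr_ge0 //; lra.
  move: LlE cE b1 {bB LE n0 lwE}; move: (L.+1%:R * lw) (c * ln_n) (ln_n * ln D%:R).
  by move: (round_bound R G) (m%:R : R) => b m' p q r; nra.
have lev := fun (W : {set V * V}) v (sW : W \subset client_pairs G) => level_bound v sW.
have := prob_halted_ge R id_inj m lev (subxx _) (@clients_sym V G) (rep0_init G id).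
apply: le_trans; rewrite lerD2l lerN2.
apply: le_trans (decay_le (q := L.+1) (w := base V) _ V0 mX); last first.
  by rewrite /base muln_gt0 expn_gt0 V0.
by rewrite ler_wpM2l ?exprn_ge0 ?divr_ge0 // ler_nat potential_le.
Qed.
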